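(* Let $(\mathcal{X},\mathcal{P})$ be a probability space and let $k:\mathcal{X}\times\mathcal{X}\to\mathbb{R}$ be a positive semi-definite kernel function with $\mathbb{E}|k(x_1,x_2)|<\infty$ for $x_1,x_2$ i.i.d. from $\mathcal{P}$. Let $z,x_1,\dots,x_n$ be i.i.d. from $\mathcal{P}$ ($n\ge 2$), and let $\mathbf{K}\in\mathbb{R}^{n\times n}$ have entries $K_{ij}=k(x_i,x_j)$. Let $\mathbf{G}\in\mathbb{R}^{n\times n}$ be the correlation matrix with entries $G_{ij}=\mathbb{E}_z[k(x_i,z)k(z,x_j)]$. Then \[ \mathbb{E}\|\mathbf{K}\| \lesssim \mathbb{E}\max_{1\le i\le n}|k(x_i,x_i)| + n\sqrt{\log n\;\mathbb{E}\big[(\mathbb{E}_z[k(x_1,z)])^2\big]} + \sqrt{n\log n\;\mathbb{E}\|\mathbf{G}\|} + \log n\sqrt{n\,\mathbb{E}\Big[\max_{1\le i\le n}\big(k(z,x_i)-\mathbb{E}_{x_i}k(z,x_i)\big)^2\Big]}, \] where $\lesssim$ hides a universal constant.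
   Context: $\|\cdot\|$ denotes the operator norm of a matrix. For independent random variables $x,y$, $\mathbb{E}_x[f(x,y)]$ denotes the conditional expectation $\mathbb{E}[f(x,y)\mid y]$ (i.e., expectation over $x$ only). $A\lesssim B$ means $A\le CB$ for a universal constant $C>0$. *)

(* Defs.v *)
From HB Require Import structures.
From mathcomp Require Import all_boot all_order all_algebra.
From mathcomp Require Import all_classical all_reals all_analysis.
Set Implicit Arguments. Unset Strict Implicit. Unset Printing Implicit Defensive.
Import Order.TTheory GRing.Theory Num.Theory.
Import numFieldNormedType.Exports.
Local Open Scope classical_set_scope.
Local Open Scope ring_scope.

Definition l2norm {R : realType} {n : nat} (u : 'cV[R]_n) : R :=
  Num.sqrt (\sum_(i < n) u i 0 ^+ 2).

Definition opnorm {R : realType} {n : nat} (A : 'M[R]_n) : \bar R :=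
  ereal_sup [set (l2norm (A *m u))%:E | u in [set u : 'cV[R]_n | l2norm u <= 1]].

Definition psd_kernel {R : realType} {X : Type} (k : X -> X -> R) : Prop :=
  (forall x y, k x y = k y x) /\
  (forall (m : nat) (xs : 'I_m -> X) (c : 'I_m -> R),
      0 <= \sum_(i < m) \sum_(j < m) c i * c j * k (xs i) (xs j)).

Definition iid_family {R : realType} {d dX : measure_display}
  {Omega : measurableType d} {X : measurableType dX} {I : finType}
  (P0 : probability Omega R) (P : probability X R) (w : I -> Omega -> X) : Prop :=
  (forall i, measurable_fun setT (w i)) /\
  (forall A : I -> set X, (forall i, measurable (A i)) ->
     P0 (\bigcap_(i in [set: I]) (w i @^-1` A i)) = (\prod_(i : I) P (A i))%E).

Definition iid_sample {R : realType} {d dX : measure_display}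
  {Omega : measurableType d} {X : measurableType dX} {n : nat}
  (P0 : probability Omega R) (P : probability X R)
  (z : Omega -> X) (x : 'I_n -> Omega -> X) : Prop :=
  iid_family P0 P (fun o : option 'I_n => if o is Some i then x i else z).

Definition kmat {R : realType} {X : Type} {n : nat} (k : X -> X -> R)
  (xs : 'I_n -> X) : 'M[R]_n := \matrix_(i, j) k (xs i) (xs j).

(* Operator norm of the correlation matrix G_ij = E_z[k(x_i,z) k(z,x_j)].
   When some diagonal entry G_ii = E_z[k(x_i,z)^2] is infinite, G is not a
   real matrix and its operator norm is taken to be +oo.  Otherwise all
   entries are finite (Cauchy-Schwarz) and the usual operator norm is used. *)
Definition opnormG {R : realType} {dX : measure_display} {X : measurableType dX}
  {n : nat} (P : probability X R) (k : X -> X -> R) (xs : 'I_n -> X) : \bar R :=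
  if [forall i, (\int[P]_y (k (xs i) y * k y (xs i))%:E < +oo)%E]
  then opnorm (\matrix_(i, j) Rintegral P setT (fun y => k (xs i) y * k y (xs j)))
  else +oo%E.

(* Main.v *)
(* The diagonal of K contributes its largest entry.  Averaging over random
   subsets T of the indices decouples the rest: it suffices to bound the matrix
   k(x_i, y_j) built from two independent samples.  Conditionally on the y_j,
   subtracting the means E_x k(x, y_j) costs n (E (E_z k)^2)^(1/2) and leaves a
   matrix with i.i.d. centred rows v(x_i), whose covariance is dominated by G.

   Such a matrix A obeys Rudelson's bound
     E |A|^2 <= C (n |G| + log n E max_i |v(x_i)|^2),
   obtained here by traces of powers, without spectral theory.  Let S be the
   sum of the v v^T over the sample, cut off at |v|^2 <= L = 2 E max |v|^2.
   The moments u^T S^j u are log-convex in j, whence, for S = S' + v v^T,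
     v^T S^q v <= e v^T S'^q v + (q+1)^q |v|^(2(q+1)).
   Resampling v independently of S' turns this into the recursion
     E tr S^(q+1) <= e n |G| E tr S'^q + n (q+1)^q L^(q+1),
   which is run up to q of order log n.  The vectors beyond the cutoff contribute
   at most 2 E max |v|^2. *)

Require Import Defs.
From HB Require Import structures.
From mathcomp Require Import all_boot all_order all_algebra.
From mathcomp Require Import all_classical all_reals all_analysis.
From mathcomp Require Import measurable_realfun ring lra.
Import Order.TTheory GRing.Theory Num.Theory.
Import numFieldNormedType.Exports.
Local Open Scope classical_set_scope.
Local Open Scope ring_scope.

(** * Quadratic forms of powers of Gram matrices *)

(** Two obstacles shape the argument. The terms of the bound may be infinite, so all expectations
    are extended-real integrals of nonnegative functions; second moments of norms are carried
    throughout and square roots enter only at the very end. Moreover the q-th moment of S involves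
    |v|^2 to comparable powers, whereas only E max |v|^2 is controlled: this is what forces the
    cutoff. An i.i.d. family has the same joint law as the family in which some coordinates are read
    off a second copy of the probability space; Tonelli on the product then isolates the resampled
    coordinates. This one device serves the trace recursion, the tail beyond the cutoff and the
    decoupling. The order log n of the power comes from replacing the norm by the trace, which costs
    a factor n: under a p-th root with n <= 2^p it costs only a constant. The last term of the bound
    arises from a row (k(x_i, y_j) - E_x k(x, y_j))_j of the cross matrix: its squared length is a
    sum over j, and moving the maximum over i inside that sum costs n. *)

Lemma sum_cauchy_schwarz {R : realDomainType} {I : finType} (a b : I -> R) :
  (\sum_i a i * b i) ^+ 2 <= (\sum_i a i ^+ 2) * (\sum_i b i ^+ 2).
Proof.
have : 0 <= \sum_i \sum_j (a i * b j - a j * b i) ^+ 2.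
  by apply: sumr_ge0 => i _; apply: sumr_ge0 => j _; rewrite sqr_ge0.
have -> : \sum_i \sum_j (a i * b j - a j * b i) ^+ 2 =
    \sum_i \sum_j a i ^+ 2 * b j ^+ 2 + \sum_i \sum_j a j ^+ 2 * b i ^+ 2
    - (\sum_i \sum_j (a i * b i) * (a j * b j)) *+ 2.
  rewrite -sumrMnl -sumrN -!big_split/=; apply: eq_bigr => i _.
  rewrite -sumrMnl -sumrN -!big_split/=; apply: eq_bigr => j _.
  by ring.
rewrite [X in _ + X - _]exchange_big/= -!big_distrlr/=.
by rewrite -expr2 -mulr2n -mulrnBl pmulrn_lge0// subr_ge0.
Qed.

(** The logarithm of [c] is convex, so it lies below its chord on [0, q]. Since terms may vanish,
    the argument compares consecutive terms by products instead of dividing. *)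
Lemma logconvex_le_geometric {R : realFieldType} (c : nat -> R) (t : R) (q j : nat) :
  (forall i, 0 <= c i) -> (forall i, c i.+1 ^+ 2 <= c i * c i.+2) ->
  0 <= t -> c q <= c 0 * t ^+ q -> (j <= q)%N -> c j <= c 0 * t ^+ j.
Proof.
move=> c0 cc t0 cq jq; rewrite leNgt; apply/negP => cj.
(* once the ratio of consecutive terms exceeds t, it stays above t *)
have step i : t * c i < c i.+1 -> t * c i.+1 < c i.+2.
  move=> h; rewrite ltNge; apply/negP => h2; move: (cc i) (c0 i) h h2 => cci ci h h2.
  have ci1 : 0 < c i.+1 by apply: le_lt_trans h; rewrite mulr_ge0.
  have : c i.+1 ^+ 2 <= c i * (t * c i.+1).
    by apply: le_trans cci _; rewrite ler_wpM2l.
  rewrite expr2 mulrA ler_pM2r// => h3; move: h; rewrite mulrC ltNge h3//.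
have above i : c 0 * t ^+ i < c i ->
    (exists2 i', (i' < i)%N & t * c i' < c i'.+1).
  elim: i => [|i ih]; first by rewrite expr0 mulr1 ltxx.
  move=> h; have [hi|hi] := ltP (t * c i) (c i.+1); first by exists i.
  have /ih[i' i'i hi'] : c 0 * t ^+ i < c i.
    rewrite ltNge; apply/negP => h2; move: h; rewrite ltNge => /negP; apply.
    by apply: le_trans hi _; rewrite exprS mulrCA ler_wpM2l.
  by exists i' => //; exact: ltnW.
have [i0 i0j hi0] := above _ cj.
have ratio k : t * c (i0 + k)%N < c (i0 + k).+1.
  by elim: k => [|k ih]; rewrite ?addn0// addnS; exact: step.
have up k : (j <= k)%N -> c 0 * t ^+ k < c k.
  elim: k => [|k ih]; first by rewrite leqn0 => /eqP j0; rewrite -j0.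
  rewrite leq_eqVlt => /orP[/eqP <- //|]; rewrite ltnS => jk.
  have := ratio (k - i0)%N; rewrite subnKC; last by rewrite (leq_trans _ jk)// ltnW.
  apply: le_lt_trans; rewrite exprS mulrCA ler_wpM2l//; apply: ltW; exact: ih.
by have := up _ jq; rewrite ltNge cq.
Qed.

(** * Moments [u^T S^j u] of a Gram matrix and their behaviour under rank-one updates *)

Section linear_algebra.
Context {R : realType} {n : nat}.
Implicit Types (u v : 'cV[R]_n) (A B V W : 'M[R]_n).

Definition sqnorm {m : nat} (u : 'cV[R]_m) : R := \sum_i u i 0 ^+ 2.

Definition qform A u v : R := (u^T *m A *m v) 0 0.

Lemma sqnorm_ge0 {m} (u : 'cV[R]_m) : 0 <= sqnorm u.
Proof. by apply: sumr_ge0 => i _; rewrite sqr_ge0. Qed.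

Lemma qformD A B u v : qform (A + B) u v = qform A u v + qform B u v.
Proof. by rewrite /qform mulmxDr mulmxDl mxE. Qed.

Lemma qform1 u : qform 1%:M u u = sqnorm u.
Proof.
by rewrite /qform mulmx1 mxE; apply: eq_bigr => i _; rewrite mxE expr2.
Qed.

Lemma qform_gram W u v :
  qform (W *m W^T) u v = \sum_i (W^T *m u) i 0 * (W^T *m v) i 0.
Proof.
rewrite /qform mulmxA -mulmxA mxE; apply: eq_bigr => i _; congr (_ * _).
by rewrite -[u^T *m W]trmxK trmx_mul trmxK mxE.
Qed.

Lemma qform_gram_ge0 W u : 0 <= qform (W *m W^T) u u.
Proof. by rewrite qform_gram; apply: sumr_ge0 => i _; rewrite -expr2 sqr_ge0. Qed.

Lemma qform_gram_CS W u v :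
  qform (W *m W^T) u v ^+ 2 <= qform (W *m W^T) u u * qform (W *m W^T) v v.
Proof. by rewrite !qform_gram; exact: sum_cauchy_schwarz. Qed.

(** This supplies positivity of all powers without square roots: with S symmetric, S^(q+2) = (S W)(S
    W)^T whenever S^q = W W^T. The step is by two, hence the induction on a pair. *)
Lemma gram_pow V (q : nat) : exists W, (V *m V^T) ^+ q = W *m W^T.
Proof.
suff : (exists W, (V *m V^T) ^+ q = W *m W^T) /\
       (exists W, (V *m V^T) ^+ q.+1 = W *m W^T) by case.
elim: q => [|q [[W hW] ih]]; split=> //.
- by exists 1%:M; rewrite expr0 trmx1 mulmx1.
- by exists V; rewrite expr1.
- exists (V *m V^T *m W); rewrite exprS exprSr hW !trmx_mul trmxK.
  by rewrite !mulmxE !mulrA.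
Qed.

Lemma mxtrace_gram W : \tr (W *m W^T) = \sum_i \sum_j W i j ^+ 2.
Proof.
by apply: eq_bigr => i _; rewrite mxE; apply: eq_bigr => j _; rewrite !mxE expr2.
Qed.

Lemma qform_le_trace W u : qform (W *m W^T) u u <= sqnorm u * \tr (W *m W^T).
Proof.
have -> : \tr (W *m W^T) = \sum_i \sum_j W^T i j ^+ 2.
  by rewrite mxtrace_mulC -{2}[W]trmxK mxtrace_gram.
rewrite qform_gram mulr_sumr; apply: ler_sum => i _; rewrite -expr2 mxE mulrC.
exact: sum_cauchy_schwarz.
Qed.

(** Cauchy-Schwarz for the semidefinite form S^j, applied to the vectors u and S u. *)
Lemma qform_pow_logconvex V u (j : nat) :
  qform ((V *m V^T) ^+ j.+1) u u ^+ 2 <=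
  qform ((V *m V^T) ^+ j) u u * qform ((V *m V^T) ^+ j.+2) u u.
Proof.
set A := V *m V^T; have [W hW] := gram_pow V j.
have At : A^T = A by rewrite trmx_mul trmxK.
have -> : qform (A ^+ j.+1) u u = qform (A ^+ j) u (A *m u).
  by rewrite /qform exprSr -mulmxE !mulmxA.
have -> : qform (A ^+ j.+2) u u = qform (A ^+ j) (A *m u) (A *m u).
  by rewrite /qform exprS exprSr -!mulmxE trmx_mul At !mulmxA.
by rewrite -/A in hW; rewrite hW; exact: qform_gram_CS.
Qed.

Lemma qform_pow_ge0 V u (j : nat) : 0 <= qform ((V *m V^T) ^+ j) u u.
Proof. by have [W ->] := gram_pow V j; exact: qform_gram_ge0. Qed.

(* Rank-one updates: expanding (A + v v^T)^q and bounding each moment v^T A^j v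
   by |v|^2 t^j, the binomial formula holds as an inequality. *)
Lemma qform_rank1_binomial A v (t : R) (q a i : nat) : 0 <= t ->
  (forall j, 0 <= qform ((A + v *m v^T) ^+ j) v v) ->
  (forall j, 0 <= qform (A ^+ j) v v) ->
  (forall j, (j <= q)%N -> qform (A ^+ j) v v <= sqnorm v * t ^+ j) ->
  (a + i <= q)%N ->
  qform (A ^+ a * (A + v *m v^T) ^+ i) v v <=
    sqnorm v * t ^+ a * (t + sqnorm v) ^+ i.
Proof.
move=> t0 f0 c0 ct; have h0 := sqnorm_ge0 v; elim: i a => [|i ih] a.
  by rewrite addn0 !expr0 !mulr1; exact: ct.
move=> aiq.
(* Peel off one factor [A + v v^T]: the part [A] moves to the left power, and the part [v v^T]
   splits the form into a product of two smaller ones. *)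
have -> : qform (A ^+ a * (A + v *m v^T) ^+ i.+1) v v =
    qform (A ^+ a.+1 * (A + v *m v^T) ^+ i) v v +
    qform (A ^+ a) v v * qform (A ^+ 0 * (A + v *m v^T) ^+ i) v v.
  rewrite exprS mulrA mulrDr mulrDl qformD exprSr; congr (_ + _).
  rewrite expr0 mul1r /qform -!mulmxE; set X := (A + _) ^+ i.
  transitivity (((v^T *m A ^+ a *m v) *m (v^T *m X *m v)) 0 0).
    by rewrite !mulmxA.
  by rewrite mxE big_ord1.
have -> : sqnorm v * t ^+ a * (t + sqnorm v) ^+ i.+1 =
    sqnorm v * t ^+ a.+1 * (t + sqnorm v) ^+ i +
    (sqnorm v * t ^+ a) * (sqnorm v * t ^+ 0 * (t + sqnorm v) ^+ i).
  by rewrite !exprS expr0; ring.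
apply: lerD; first by apply: ih; rewrite addSn -addnS.
apply: ler_pM => //; last 2 first.
- by apply: ct; apply: leq_trans aiq; exact: leq_addr.
- by apply: ih; apply: leq_trans aiq; rewrite add0n addnS ltnW// ltnS leq_addl.
by rewrite expr0 mul1r.
Qed.

(** Write the q-th moment of [A] as h t^q with h = |v|^2; the binomial bound gives h (t + h)^q. If t
    <= q h this is at most h ((q+1) h)^q, the second term; otherwise (t + h)^q <= (1 + 1/q)^q t^q <=
    e t^q, the first term. *)
Lemma qform_rank1_pow A v (q : nat) :
  (forall j, 0 <= qform ((A + v *m v^T) ^+ j) v v) ->
  (forall j, 0 <= qform (A ^+ j) v v) ->
  (forall j, qform (A ^+ j.+1) v v ^+ 2 <=
     qform (A ^+ j) v v * qform (A ^+ j.+2) v v) ->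
  qform ((A + v *m v^T) ^+ q) v v <=
    expR 1 * qform (A ^+ q) v v + q.+1%:R ^+ q * sqnorm v ^+ q.+1.
Proof.
move=> f0 c0 cc; set h := sqnorm v; have h0 : 0 <= h := sqnorm_ge0 v.
have c0h : qform (A ^+ 0) v v = h by rewrite expr0 qform1.
have main t : 0 <= t -> qform (A ^+ q) v v <= h * t ^+ q ->
    qform ((A + v *m v^T) ^+ q) v v <= h * (t + h) ^+ q.
  move=> t0 ct.
  have := @qform_rank1_binomial A v t q 0 q t0 f0 c0.
  rewrite expr0 mul1r expr0 mulr1; apply; rewrite ?add0n// => j jq.
  rewrite -/h -c0h.
  by apply: (@logconvex_le_geometric _ (fun j => qform (A ^+ j) v v)) jq => //; rewrite c0h.
have [cq|cq] := leP (qform (A ^+ q) v v) (h * (q%:R * h) ^+ q).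
  have qh0 : 0 <= q%:R * h by rewrite mulr_ge0.
  apply: le_trans (main _ qh0 cq) _.
  have -> : h * (q%:R * h + h) ^+ q = q.+1%:R ^+ q * h ^+ q.+1.
    by rewrite exprS mulrCA -exprMn -natr1 mulrDl mul1r.
  by rewrite lerDr mulr_ge0// expR_ge0.
have q0 : (0 < q)%N.
  by case: q cq {main} => // cq; move: cq; rewrite c0h expr0 mulr1 ltxx.
(* If h = 0 the moment of order 0 vanishes, and log-convexity propagates the zero to every order,
   against [cq]. *)
have hp : 0 < h.
  rewrite lt_neqAle h0 andbT eq_sym; apply/eqP => h00.
  move: cq; rewrite h00 mul0r => cq.
  have : forall j, qform (A ^+ j) v v <= 0.
    elim=> [|j ih]; first by rewrite c0h h00.
    have : qform (A ^+ j.+1) v v ^+ 2 == 0.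
      by rewrite eq_le sqr_ge0 andbT (le_trans (cc j))// mulr_le0_ge0.
    by rewrite sqrf_eq0 => /eqP ->.
  by move=> /(_ q); rewrite leNgt cq.
set r := qform (A ^+ q) v v / h.
have r0 : 0 <= r by rewrite divr_ge0.
set t := r `^ (q%:R^-1).
have t0 : 0 <= t := powR_ge0 _ _.
have tq : t ^+ q = r.
  by rewrite -powR_mulrn// -powRrM mulVf ?powRr1// pnatr_eq0 -lt0n.
have cqE : qform (A ^+ q) v v = h * t ^+ q by rewrite tq mulrC divfK// gt_eqF.
have : qform ((A + v *m v^T) ^+ q) v v <= h * (t + h) ^+ q.
  by apply: main; rewrite // cqE.
move=> /le_trans; apply.
have qht : q%:R * h <= t.
  rewrite leNgt; apply/negP => tqh; move: cq; rewrite cqE ltNge => /negP; apply.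
  by rewrite ler_wpM2l// lerXn2r ?nnegrE ?mulr_ge0// ltW.
have ht : h <= q%:R^-1 * t by rewrite -ler_pdivrMl ?invr_gt0 ?ltr0n// invrK.
have : h * (t + h) ^+ q <= expR 1 * (h * t ^+ q).
  rewrite mulrCA ler_wpM2l//.
  have -> : expR 1 * t ^+ q = (expR (q%:R^-1) * t) ^+ q.
    by rewrite exprMn -expRM_natl divff// pnatr_eq0 -lt0n.
  rewrite lerXn2r ?nnegrE ?addr_ge0 ?mulr_ge0 ?expR_ge0//.
  apply: le_trans (_ : (1 + q%:R^-1) * t <= _).
    by rewrite mulrDl mul1r lerD2l.
  by rewrite ler_wpM2r// expR_ge1Dx.
move=> /le_trans; apply; rewrite cqE lerDl mulr_ge0// ?exprn_ge0//.
Qed.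

(* With t the factor on the right, t^(p+1) dominates the trace of the (p+1)-st
   power; the log-convex moments then give the first one. *)
Lemma qform_gram_le V u (M : R) (p : nat) : 0 < M ->
  qform (V *m V^T) u u <=
    sqnorm u * (M + \tr ((V *m V^T) ^+ p.+1) / M ^+ p).
Proof.
move=> M0; set T := \tr _; set t := M + _.
have [W hW] := gram_pow V p.+1.
have T0 : 0 <= T.
  rewrite /T hW mxtrace_gram; apply: sumr_ge0 => i _; apply: sumr_ge0 => j _.
  by rewrite sqr_ge0.
have Mp : 0 < M ^+ p by rewrite exprn_gt0.
have TM0 : 0 <= T / M ^+ p by rewrite divr_ge0// ltW.
have t0 : 0 <= t by rewrite addr_ge0// ltW.
have := @logconvex_le_geometric _ (fun j => qform ((V *m V^T) ^+ j) u u) t p.+1 1.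
rewrite expr1 expr0 qform1 expr1; apply=> //.
- by move=> i; exact: qform_pow_ge0.
- by move=> i; exact: qform_pow_logconvex.
rewrite hW; apply: le_trans (qform_le_trace _ _) _; rewrite -hW -/T.
rewrite ler_wpM2l ?sqnorm_ge0//.
have -> : T = (T / M ^+ p) * M ^+ p by rewrite divfK// gt_eqF.
rewrite exprS ler_pM ?exprn_ge0// ?(ltW M0)//; first by rewrite /t lerDr ltW.
by rewrite lerXn2r ?nnegrE ?(ltW M0)// /t lerDl.
Qed.

End linear_algebra.

(** * The operator norm *)

Section operator_norm.
Context {R : realType}.

Lemma l2normE {n} (u : 'cV[R]_n) : l2norm u = Num.sqrt (sqnorm u).
Proof. by []. Qed.

Lemma l2norm_ge0 {n} (u : 'cV[R]_n) : 0 <= l2norm u.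
Proof. exact: sqrtr_ge0. Qed.

Lemma sqr_l2norm {n} (u : 'cV[R]_n) : l2norm u ^+ 2 = sqnorm u.
Proof. by rewrite sqr_sqrtr// sqnorm_ge0. Qed.

Lemma l2norm_le1 {n} (u : 'cV[R]_n) : (l2norm u <= 1) = (sqnorm u <= 1).
Proof. by rewrite -sqr_l2norm -[in RHS](expr1n _ 2) ler_pXn2r ?nnegrE ?l2norm_ge0. Qed.

Lemma l2norm_le {n m} (u : 'cV[R]_n) (v : 'cV[R]_m) :
  sqnorm u <= sqnorm v -> l2norm u <= l2norm v.
Proof. by move=> uv; rewrite !l2normE ler_wsqrtr. Qed.

Lemma l2normD {n} (u v : 'cV[R]_n) : l2norm (u + v) <= l2norm u + l2norm v.
Proof.
rewrite -(@ler_pXn2r _ 2)// ?nnegrE ?addr_ge0 ?l2norm_ge0//.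
rewrite sqrrD !sqr_l2norm.
have -> : sqnorm (u + v) =
    sqnorm u + (\sum_i u i 0 * v i 0) *+ 2 + sqnorm v.
  rewrite /sqnorm -sumrMnl -!big_split/=; apply: eq_bigr => i _.
  by rewrite mxE sqrrD.
rewrite lerD2r lerD2l ler_wMn2r//.
rewrite (le_trans (ler_norm _))// -(@ler_pXn2r _ 2)// ?nnegrE ?mulr_ge0 ?l2norm_ge0//.
rewrite real_normK ?num_real// exprMn !sqr_l2norm.
exact: (sum_cauchy_schwarz (fun i => u i 0) (fun i => v i 0)).
Qed.

Lemma sqnormZ {n} (c : R) (u : 'cV[R]_n) : sqnorm (c *: u) = c ^+ 2 * sqnorm u.
Proof. by rewrite mulr_sumr; apply: eq_bigr => i _; rewrite mxE exprMn. Qed.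

Lemma l2normZ {n} (c : R) (u : 'cV[R]_n) : l2norm (c *: u) = `|c| * l2norm u.
Proof. by rewrite !l2normE sqnormZ sqrtrM ?sqr_ge0// sqrtr_sqr. Qed.

Lemma l2norm0 {n} : l2norm (0 : 'cV[R]_n) = 0.
Proof. by rewrite -(scale0r (0 : 'cV[R]_n)) l2normZ normr0 mul0r. Qed.

Lemma sqnorm_mulmx_le {n} (A : 'M[R]_n) (u : 'cV[R]_n) :
  sqnorm (A *m u) <= (\sum_i \sum_j A i j ^+ 2) * sqnorm u.
Proof.
rewrite mulr_suml; apply: ler_sum => i _; rewrite mxE.
exact: (sum_cauchy_schwarz (A i) (fun j => u j 0)).
Qed.

Lemma opnorm_ub {n} (A : 'M[R]_n) (u : 'cV[R]_n) : l2norm u <= 1 ->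
  ((l2norm (A *m u))%:E <= opnorm A)%E.
Proof. by move=> u1; apply: ereal_sup_ubound; exists u. Qed.

Lemma opnorm_le {n} (A : 'M[R]_n) (c : \bar R) :
  (forall u : 'cV[R]_n, l2norm u <= 1 -> ((l2norm (A *m u))%:E <= c)%E) ->
  (opnorm A <= c)%E.
Proof. by move=> h; apply: ge_ereal_sup => _ [u u1 <-]; exact: h. Qed.

Lemma opnorm_ge0 {n} (A : 'M[R]_n) : (0 <= opnorm A)%E.
Proof.
apply: le_trans (opnorm_ub A 0 _); first by rewrite lee_fin l2norm_ge0.
by rewrite l2norm0.
Qed.

(** The Frobenius norm bounds the supremum, so nothing is lost in passing to a real number; see
    [opnE]. *)
Definition opn {n} (A : 'M[R]_n) : R := fine (opnorm A).

Lemma opnE {n} (A : 'M[R]_n) : (opn A)%:E = opnorm A.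
Proof.
rewrite /opn fineK// ge0_fin_numE ?opnorm_ge0//.
apply: (@le_lt_trans _ _ (Num.sqrt (\sum_i \sum_j A i j ^+ 2))%:E); last by rewrite ltry.
apply: opnorm_le => u; rewrite l2norm_le1 lee_fin => u1.
rewrite l2normE ler_wsqrtr// (le_trans (sqnorm_mulmx_le _ _))// ler_piMr//.
by apply: sumr_ge0 => i _; apply: sumr_ge0 => j _; rewrite sqr_ge0.
Qed.

Lemma opn_ge0 {n} (A : 'M[R]_n) : 0 <= opn A.
Proof. by rewrite -lee_fin opnE opnorm_ge0. Qed.

Lemma opn_le {n} (A : 'M[R]_n) (c : R) :
  (forall u : 'cV[R]_n, l2norm u <= 1 -> l2norm (A *m u) <= c) -> opn A <= c.
Proof. by move=> h; rewrite -lee_fin opnE; apply: opnorm_le. Qed.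

Lemma opn_ub1 {n} (A : 'M[R]_n) (u : 'cV[R]_n) : l2norm u <= 1 ->
  l2norm (A *m u) <= opn A.
Proof. by move=> u1; rewrite -lee_fin opnE opnorm_ub. Qed.

Lemma opn_ub {n} (A : 'M[R]_n) (u : 'cV[R]_n) :
  l2norm (A *m u) <= opn A * l2norm u.
Proof.
have [u0|u0] := eqVneq (l2norm u) 0.
  have : sqnorm (A *m u) <= 0.
    by rewrite (le_trans (sqnorm_mulmx_le _ _))// -sqr_l2norm u0 expr0n mulr0.
  by move=> Au0; rewrite u0 mulr0 l2normE -[leRHS]sqrtr0 ler_wsqrtr.
have up : 0 < l2norm u by rewrite lt_neqAle eq_sym u0 l2norm_ge0.
have := @opn_ub1 _ A ((l2norm u)^-1 *: u).
rewrite -scalemxAr !l2normZ ger0_norm ?invr_ge0 ?l2norm_ge0// mulVf//.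
by move=> /(_ (lexx _)); rewrite ler_pdivrMl// mulrC.
Qed.

Lemma opn_sqr_le {n} (A : 'M[R]_n) (z : R) : 0 <= z ->
  (forall u : 'cV[R]_n, sqnorm (A *m u) <= z * sqnorm u) -> opn A ^+ 2 <= z.
Proof.
move=> z0 h; rewrite -[leRHS]sqr_sqrtr// ler_pXn2r ?nnegrE ?opn_ge0 ?sqrtr_ge0//.
apply: opn_le => u; rewrite l2norm_le1 => u1.
by rewrite ler_wsqrtr// (le_trans (h u))// ler_piMr.
Qed.

Lemma opnD {n} (A B : 'M[R]_n) : opn (A + B) <= opn A + opn B.
Proof.
apply: opn_le => u u1; rewrite mulmxDl (le_trans (l2normD _ _))//.
by apply: lerD; exact: opn_ub1.
Qed.

Lemma opnZ {n} (c : R) (A : 'M[R]_n) : 0 <= c -> opn (c *: A) <= c * opn A.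
Proof.
move=> c0; apply: opn_le => u u1; rewrite -scalemxAl l2normZ ger0_norm//.
by rewrite ler_wpM2l// opn_ub1.
Qed.

Lemma opn_sum {n} {I : finType} (A : I -> 'M[R]_n) :
  opn (\sum_i A i) <= \sum_i opn (A i).
Proof.
elim/big_ind2 : _ => // [|x1 x2 y1 y2 h1 h2].
  by apply: opn_le => u u1; rewrite mul0mx l2norm0.
by rewrite (le_trans (opnD _ _))// lerD.
Qed.

(** Such a mask multiplies by coordinate projections on both sides, and these are contractions. It
    removes the index set after decoupling. *)
Lemma opn_mask {n} (a b : 'I_n -> bool) (A : 'M[R]_n) :
  opn (\matrix_(i, j) ((a i && b j)%:R * A i j)) <= opn A.
Proof.
apply: opn_le => u u1; pose v : 'cV[R]_n := \col_j ((b j)%:R * u j 0).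
have v1 : l2norm v <= 1.
  apply: le_trans u1; apply: l2norm_le; apply: ler_sum => i _; rewrite mxE.
  by case: (b i); rewrite ?mul1r// mul0r expr0n sqr_ge0.
apply: le_trans (opn_ub1 A v v1); apply: l2norm_le; apply: ler_sum => i _.
have -> : ((\matrix_(i, j) ((a i && b j)%:R * A i j)) *m u) i 0 =
    (a i)%:R * (A *m v) i 0.
  rewrite !mxE mulr_sumr; apply: eq_bigr => j _; rewrite !mxE.
  by case: (a i); case: (b j); rewrite ?(mul0r, mulr0, mul1r).
by case: (a i); rewrite ?mul1r// mul0r expr0n sqr_ge0.
Qed.

(** The absolute value on the right covers n = 0, where the sign of [M] is unconstrained. *)
Lemma opn_diag {n} (c : 'I_n -> R) (M : R) : (forall i, `|c i| <= M) ->
  opn (\matrix_(i, j) ((i == j)%:R * c i)) <= `|M|.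
Proof.
move=> cM; apply: opn_le => u u1.
rewrite -[leRHS]mulr1 (le_trans _ (ler_wpM2l _ u1))// -l2normZ.
apply: l2norm_le; apply: ler_sum => i _; rewrite !mxE (bigD1 i)//= mxE eqxx mul1r.
rewrite big1 ?addr0; last by move=> j ji; rewrite mxE eq_sym (negbTE ji) !mul0r.
rewrite !exprMn ler_wpM2r ?sqr_ge0// -[leLHS]real_normK ?num_real//.
rewrite -[leRHS]real_normK ?num_real// ler_pXn2r ?nnegrE//.
by rewrite (le_trans (cM i))// ler_norm.
Qed.

Lemma qform_le_opn {n} (A : 'M[R]_n) (u : 'cV[R]_n) :
  qform A u u <= opn A * sqnorm u.
Proof.
rewrite /qform -mulmxA mxE.
apply: (@le_trans _ _ (l2norm u * l2norm (A *m u))).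
  rewrite (le_trans (ler_norm _))// -(@ler_pXn2r _ 2)// ?nnegrE ?mulr_ge0 ?l2norm_ge0//.
  rewrite real_normK ?num_real// exprMn !sqr_l2norm.
  apply: le_trans (sum_cauchy_schwarz (fun i => u i 0) (fun i => (A *m u) i 0)).
  by under eq_bigr do rewrite mxE.
rewrite -sqr_l2norm expr2 mulrA [leRHS]mulrC ler_wpM2l ?l2norm_ge0//.
exact: opn_ub.
Qed.

(** Rounding towards zero, so that rational approximations of a vector of the unit ball stay in the
    unit ball. *)
Lemma rat_shrink (a e : R) : 0 < e ->
  exists2 q : rat, `|ratr q| <= `|a| & `|a - ratr q| <= e.
Proof.
move=> e0; wlog a0 : a / 0 <= a => [hw|].
  have [a0|a0] := leP 0 a; first exact: hw.
  have [|q q1 q2] := hw (- a); first by rewrite oppr_ge0 ltW.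
  rewrite normrN in q1; exists (- q); rewrite raddfN/= ?normrN//.
  by rewrite opprK -normrN opprD.
have [->|an0] := eqVneq a 0.
  by exists 0; rewrite rmorph0 ?subrr normr0// ltW.
have ap : 0 < a by rewrite lt_neqAle eq_sym an0.
have lt : Num.max 0 (a - e) < a by rewrite gt_max ap/= gtrBl.
have [q] := rat_in_itvoo lt; rewrite in_itv/= gt_max => /andP[/andP[q0 q1] q2].
exists q; first by rewrite !ger0_norm// ltW.
by rewrite ger0_norm ?subr_ge0 1?ltW// ltrBlDr addrC -ltrBlDr.
Qed.

Definition ratcol n (k : nat) : 'cV[R]_n :=
  map_mx ratr (odflt 0 (unpickle k : option 'cV[rat]_n)).

Lemma ratcol_dense n (u : 'cV[R]_n) (e : R) : 0 < e -> exists k,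
  sqnorm (ratcol n k) <= sqnorm u /\ sqnorm (u - ratcol n k) <= n%:R * e ^+ 2.
Proof.
move=> e0.
have /choice[q hq] : forall i, exists q : rat,
    `|ratr q : R| <= `|u i 0| /\ `|u i 0 - ratr q| <= e.
  by move=> i; have [q q1 q2] := rat_shrink (u i 0) e e0; exists q.
exists (pickle (\col_i q i : 'cV[rat]_n)); rewrite /ratcol pickleK/=; split.
  apply: ler_sum => i _; rewrite !mxE -[leLHS]real_normK ?num_real//.
  rewrite -[leRHS]real_normK ?num_real// ler_pXn2r ?nnegrE//.
  by case: (hq i).
rewrite mulr_natl -[X in _ *+ X]card_ord -sumr_const; apply: ler_sum => i _.
rewrite !mxE -[leLHS]real_normK ?num_real// ler_pXn2r ?nnegrE ?(ltW e0)//.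
by case: (hq i).
Qed.

(* A countable supremum, from which measurability follows. *)
Lemma opnorm_esups {n} (A : 'M[R]_n) :
  opnorm A = esups (fun k => if l2norm (ratcol n k) <= 1
    then (l2norm (A *m ratcol n k))%:E else 0%E) 0.
Proof.
apply/eqP; rewrite eq_le; apply/andP; split; last first.
  apply: ge_ereal_sup => _ [k _ <-]; case: ifPn => [k1|_]; last exact: opnorm_ge0.
  exact: opnorm_ub.
apply: opnorm_le => u u1; apply/lee_addgt0Pr => e e0.
pose F := \sum_i \sum_j A i j ^+ 2.
have F0 : 0 <= F.
  by apply: sumr_ge0 => i _; apply: sumr_ge0 => j _; rewrite sqr_ge0.
(* With [F] the squared Frobenius norm, moving each coordinate by at most [d] moves the image by at
   most sqrt(F n) d <= e; the summand 1 keeps the denominator positive. *)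
pose d := e / (1 + Num.sqrt (F * n%:R)).
have c0 : 0 < 1 + Num.sqrt (F * n%:R) by rewrite ltr_wpDr ?sqrtr_ge0.
have d0 : 0 < d by rewrite divr_gt0.
have [k [k1 k2]] := ratcol_dense n u d d0.
have kle : l2norm (ratcol n k) <= 1 by rewrite (le_trans _ u1)// l2norm_le.
apply: (@le_trans _ _ ((l2norm (A *m ratcol n k))%:E + e%:E)%E).
  rewrite -EFinD lee_fin.
  have -> : A *m u = A *m ratcol n k + A *m (u - ratcol n k).
    by rewrite -mulmxDr addrC subrK.
  rewrite (le_trans (l2normD _ _))// lerD2l l2normE.
  apply: (@le_trans _ _ (Num.sqrt (F * (n%:R * d ^+ 2)))).
    rewrite ler_wsqrtr// (le_trans (sqnorm_mulmx_le _ _))//.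
    by rewrite ler_wpM2l.
  rewrite mulrA sqrtrM ?mulr_ge0// sqrtr_sqr ger0_norm ?(ltW d0)//.
  by rewrite /d mulrA ler_pdivrMr// mulrC ler_wpM2l ?(ltW e0)// lerDr.
rewrite leeD2r//; apply: ereal_sup_ubound; exists k => //=.
by rewrite kle.
Qed.

End operator_norm.

(** * Measurability and joint laws of i.i.d. families *)

Section measurability.
Context {R : realType} {d : measure_display} {T : measurableType d}.

Definition mxmeasurable {m n} (A : T -> 'M[R]_(m, n)) :=
  forall i j, measurable_fun setT (fun t => A t i j).

Lemma mxmeasurable_mx {m n} (F : 'I_m -> 'I_n -> T -> R) :
  (forall i j, measurable_fun setT (F i j)) ->
  mxmeasurable (fun t => \matrix_(i, j) F i j t).
Proof. by move=> mF i j; under eq_fun do rewrite mxE; exact: mF. Qed.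

Lemma mxmeasurableM {m n p} (A : T -> 'M[R]_(m, n)) (B : T -> 'M[R]_(n, p)) :
  mxmeasurable A -> mxmeasurable B -> mxmeasurable (fun t => A t *m B t).
Proof.
move=> mA mB i j; under eq_fun do rewrite mxE.
by apply: measurable_sum => k; exact: measurable_funM.
Qed.

Lemma mxmeasurable_tr {m n} (A : T -> 'M[R]_(m, n)) :
  mxmeasurable A -> mxmeasurable (fun t => (A t)^T).
Proof. by move=> mA i j; under eq_fun do rewrite mxE; exact: mA. Qed.

Lemma mxmeasurable_cst {m n} (A : 'M[R]_(m, n)) : mxmeasurable (fun=> A).
Proof. by move=> i j; exact: measurable_cst. Qed.

Lemma mxmeasurableX {n} (A : T -> 'M[R]_n) q :
  mxmeasurable A -> mxmeasurable (fun t => A t ^+ q).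
Proof.
move=> mA; elim: q => [|q ih]; first exact: mxmeasurable_cst.
by under eq_fun do rewrite exprS -mulmxE; exact: mxmeasurableM.
Qed.

Lemma measurable_mxtrace {n} (A : T -> 'M[R]_n) :
  mxmeasurable A -> measurable_fun setT (fun t => \tr (A t)).
Proof. by move=> mA; apply: measurable_sum => k; exact: mA. Qed.

Lemma measurable_sqnorm {n} (u : T -> 'cV[R]_n) :
  mxmeasurable u -> measurable_fun setT (fun t => sqnorm (u t)).
Proof. by move=> mu; apply: measurable_sum => k; exact/measurable_funX/mu. Qed.

Lemma measurable_qform {n} (A : T -> 'M[R]_n) (u v : T -> 'cV[R]_n) :
  mxmeasurable A -> mxmeasurable u -> mxmeasurable v ->
  measurable_fun setT (fun t => qform (A t) (u t) (v t)).
Proof.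
move=> mA mu mv; apply: (mxmeasurableM (fun t => (u t)^T *m A t)) => //.
by apply: mxmeasurableM => //; exact: mxmeasurable_tr.
Qed.

Lemma measurable_opnorm {n} (A : T -> 'M[R]_n) :
  mxmeasurable A -> measurable_fun setT (fun t => opnorm (A t)).
Proof.
move=> mA.
have -> : (fun t => opnorm (A t)) = (fun t =>
    esups (fun k => if l2norm (ratcol n k : 'cV[R]_n) <= 1
      then (l2norm (A t *m ratcol n k))%:E else 0%E) 0).
  by apply/funext => t; exact: opnorm_esups.
apply: measurable_fun_esups => k.
have [_|_] := boolP (l2norm (ratcol n k : 'cV[R]_n) <= 1); last exact: measurable_cst.
apply/measurable_EFinP.
change (measurable_fun setT (Num.sqrt \o (fun t => sqnorm (A t *m ratcol n k)))).
apply: measurableT_comp.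
  exact: continuous_measurable_fun (@sqrt_continuous R).
apply: measurable_sqnorm.
by apply: mxmeasurableM => //; exact: mxmeasurable_cst.
Qed.

Lemma measurable_opn {n} (A : T -> 'M[R]_n) :
  mxmeasurable A -> measurable_fun setT (fun t => opn (A t)).
Proof.
move=> mA; apply: (@measurableT_comp _ _ _ _ _ _ fine _ (fun t => opnorm (A t))).
  exact: fine_measurable.
exact: measurable_opnorm.
Qed.

Lemma measurable_bigmax {I : Type} (r : seq I) (f : I -> T -> R) :
  (forall i, measurable_fun setT (f i)) ->
  measurable_fun setT (fun t => \big[Num.max/0]_(i <- r) f i t).
Proof.
move=> mf; elim: r => [|i r ih].
  by under eq_fun do rewrite big_nil; exact: measurable_cst.
by under eq_fun do rewrite big_cons; exact: measurable_maxr.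
Qed.

End measurability.

Lemma ge0_le_integral_mu {R : realType} {d} {T : measurableType d}
    (mu : {measure set T -> \bar R}) (f g : T -> \bar R) :
  measurable_fun setT f -> measurable_fun setT g ->
  (forall t, 0 <= f t)%E -> (forall t, f t <= g t)%E ->
  (\int[mu]_t f t <= \int[mu]_t g t)%E.
Proof. by move=> mf mg f0 fg; exact: ge0_le_integral. Qed.

(** * The product sigma-algebra on families indexed by a finite type *)

Section cylinders.
Context {dX : measure_display} {X : measurableType dX} {I : finType}.

Definition box (A : I -> set X) : set (I -> X) :=
  \bigcap_(i in [set: I]) ((fun f => f i) @^-1` A i).

Definition boxes : set (set (I -> X)) :=
  [set B | exists2 A : I -> set X, (forall i, measurable (A i)) & B = box A].

(** Generated by the boxes because they form a pi-system on which the i.i.d. property prescribes the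
    joint law. *)
Definition family_space := g_sigma_algebraType boxes.

Lemma measurable_coord (i : I) :
  measurable_fun [set: family_space] (fun f : family_space => f i).
Proof.
move=> _ A mA; rewrite setTI; apply: sub_sigma_algebra.
exists (fun j => if j == i then A else setT); first by move=> j; case: ifP.
apply/seteqP; split => [f /= fA j _ /=|f /(_ i Logic.I)/=]; last by rewrite eqxx.
by case: ifP => // /eqP ->.
Qed.

Lemma boxes_setI_closed : setI_closed boxes.
Proof.
move=> _ _ [A mA ->] [B mB ->]; exists (fun i => A i `&` B i).
  by move=> i; exact: measurableI.
by rewrite /box -bigcapI; apply: eq_bigcapr => i _; rewrite preimage_setI.
Qed.

End cylinders.
Arguments family_space {dX} X I.

Section joint_law.
Context {R : realType} {dX : measure_display} {X : measurableType dX}.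
Variable P : probability X R.

Lemma measurable_family {d} {Omega : measurableType d} {I : finType}
    (w : I -> Omega -> X) : (forall i, measurable_fun setT (w i)) ->
  measurable_fun setT ((fun t => w^~ t) : Omega -> family_space X I).
Proof.
move=> mw.
apply: (@measurability _ _ Omega (family_space X I) setT (fun t => w^~ t) boxes) => //.
move=> _ [_ [A mA ->] <-]; rewrite setTI preimage_bigcap.
apply: fin_bigcap_measurable => [|i _]; first exact: finite_finset.
by rewrite -[X in measurable X]setTI; exact: mw.
Qed.

(** Both push-forwards agree on boxes, hence everywhere by uniqueness of measures on a pi-system.
    The two families may live on different probability spaces, which is what allows sampling from a
    product space instead. *)
Lemma iid_family_law_unique {d1 d2} {O1 : measurableType d1} {O2 : measurableType d2}
    {I : finType} (m1 : probability O1 R) (m2 : probability O2 R)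
    (w1 : I -> O1 -> X) (w2 : I -> O2 -> X) (f : family_space X I -> \bar R) :
  iid_family m1 P w1 -> iid_family m2 P w2 ->
  measurable_fun setT f -> (forall x, 0 <= f x)%E ->
  (\int[m1]_t f (w1^~ t) = \int[m2]_t f (w2^~ t))%E.
Proof.
move=> [mw1 p1] [mw2 p2] mf f0.
have mW1 := measurable_family w1 mw1; have mW2 := measurable_family w2 mw2.
pose h1 := isMeasurableFun.Build _ _ _ _ _ mW1.
pose h2 := isMeasurableFun.Build _ _ _ _ _ mW2.
pose W1 : {mfun O1 >-> family_space X I} := HB.pack ((fun t => w1^~ t) : O1 -> family_space X I) h1.
pose W2 : {mfun O2 >-> family_space X I} := HB.pack ((fun t => w2^~ t) : O2 -> family_space X I) h2.
have e1 := @ge0_integral_pushforward _ _ _ _ _ _ mW1 m1 setT f measurableT mf (fun x _ => f0 x).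
have e2 := @ge0_integral_pushforward _ _ _ _ _ _ mW2 m2 setT f measurableT mf (fun x _ => f0 x).
rewrite preimage_setT in e1; rewrite preimage_setT in e2.
rewrite -[LHS]e1 -[RHS]e2.
apply: (@eq_measure_integral _ _ _ _ (pushforward m2 W2) (pushforward m1 W1)) => A mA _.
apply: (@measure_unique _ _ (family_space X I) boxes (fun=> setT)) => //.
- exact: boxes_setI_closed.
- move=> _; exists (fun=> setT) => //.
  by apply/seteqP; split=> // x _ i.
- by apply/seteqP; split=> // x _; exists 0%N.
- move=> _ [B mB ->].
  by transitivity (\prod_(i : I) P (B i))%E; [exact: p1|symmetry; exact: p2].
- move=> _; change (m1 setT < +oo)%E.
  have -> : [set: O1] = \bigcap_(i in [set: I]) (w1 i @^-1` setT).
    by apply/seteqP; split=> // x _ i.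
  by rewrite p1// big1 ?ltry// => i _; exact: probability_setT.
Qed.
End joint_law.

(** * Resampling *)

Section resampling.
Context {R : realType} {dX : measure_display} {X : measurableType dX}.
Variable P : probability X R.

Lemma iid_family_prod {d1 d2} {O1 : measurableType d1} {O2 : measurableType d2}
    {I1 I2 : finType} (m1 : probability O1 R) (m2 : probability O2 R)
    (w1 : I1 -> O1 -> X) (w2 : I2 -> O2 -> X) :
  iid_family m1 P w1 -> iid_family m2 P w2 ->
  iid_family (m1 \x m2)%E P (fun (s : I1 + I2) t =>
    match s with inl i => w1 i t.1 | inr i => w2 i t.2 end).
Proof.
move=> [mw1 p1] [mw2 p2]; split=> [[i|i]|A mA].
- exact: (measurableT_comp (mw1 i) measurable_fst).
- exact: (measurableT_comp (mw2 i) measurable_snd).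
have -> : \bigcap_(i in [set: (I1 + I2)%type]) ((fun t =>
      match i with inl j => w1 j t.1 | inr j => w2 j t.2 end) @^-1` A i) =
   (\bigcap_(i in [set: I1]) (w1 i @^-1` A (inl i))) `*`
   (\bigcap_(i in [set: I2]) (w2 i @^-1` A (inr i))).
  apply/seteqP; split=> [[t1 t2] h|[t1 t2] [/= h1 h2] [i|i] _].
  - by split=> i _; [exact: (h (inl i))|exact: (h (inr i))].
  - exact: h1.
  - exact: h2.
have mcap d (O : measurableType d) (I : finType) (w : I -> O -> X)
    (B : I -> set X) : (forall i, measurable_fun setT (w i)) ->
    (forall i, measurable (B i)) ->
    measurable (\bigcap_(i in [set: I]) (w i @^-1` B i)).
  move=> mw mB; apply: fin_bigcap_measurable => [|i _]; first exact: finite_finset.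
  by rewrite -[X in measurable X]setTI; exact: mw.
transitivity (m1 (\bigcap_(i in [set: I1]) (w1 i @^-1` A (inl i))) *
              m2 (\bigcap_(i in [set: I2]) (w2 i @^-1` A (inr i))))%E.
  by apply: product_measure1E; exact: mcap.
by rewrite big_sumType/= p1// p2.
Qed.

Lemma iid_family_sub {d} {Omega : measurableType d} {I J : finType}
    (m : probability Omega R) (w : I -> Omega -> X) (s : J -> I) :
  injective s -> iid_family m P w -> iid_family m P (fun j => w (s j)).
Proof.
move=> sI [mw pw]; split=> [j|A mA]; first exact: mw.
(* Indices outside the image of [s] receive the whole space, a factor 1 in the product; injectivity
   makes the preimage unique. *)
pose B i := if [pick j | s j == i] is Some j then A j else setT.
have Bs j : B (s j) = A j.
  rewrite /B; case: pickP => [j' /eqP /sI -> //|/(_ j)]; by rewrite eqxx.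
have mB i : measurable (B i) by rewrite /B; case: pickP.
have -> : \bigcap_(j in [set: J]) (w (s j) @^-1` A j) =
    \bigcap_(i in [set: I]) (w i @^-1` B i).
  apply/seteqP; split=> t h j _ /=; last by rewrite -Bs; exact: h.
  by rewrite /B; case: pickP => // j' /eqP <-; exact: h.
rewrite pw// (bigID (fun i => i \in s @: [set: J]%SET))/= [X in (_ * X)%E]big1 ?mule1.
  rewrite big_imset/=; last by move=> ? ? _ _; exact: sI.
  by apply: eq_big => [j|j _]; rewrite ?inE// Bs.
move=> i /imsetP inN; rewrite /B; case: pickP => [j /eqP ji|_].
  by exfalso; apply: inN; exists j.
exact: probability_setT.
Qed.

Lemma iid_family_marginal {d} {Omega : measurableType d} {I : finType}
    (m : probability Omega R) (w : I -> Omega -> X) (i : I)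
    (f : X -> \bar R) :
  iid_family m P w -> measurable_fun setT f -> (forall x, 0 <= f x)%E ->
  (\int[m]_t f (w i t) = \int[P]_x f x)%E.
Proof.
move=> pw mf f0.
have p1 : iid_family m P (fun _ : 'I_1 => w i).
  by apply: (iid_family_sub m w (fun=> i)) => // j j' _; rewrite !ord1.
have p2 : iid_family P P (fun (_ : 'I_1) (x : X) => x).
  split=> [_|A mA]; first exact: measurable_id.
  rewrite big_ord1; congr (P _); apply/seteqP; split=> x; first by move=> /(_ ord0); exact.
  by move=> Ax j _; rewrite ord1.
apply: (iid_family_law_unique P m P _ _ (fun g : family_space X 'I_1 => f (g ord0)) p1 p2) => //.
exact: (measurableT_comp mf (measurable_coord _)).
Qed.

(** The coordinates in [T] are the resampled ones: they come from the second copy. *)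
Definition splice {Omega : Type} {I : Type} (T : pred I) (w : I -> Omega -> X)
  (t : Omega * Omega) : I -> X := fun i => if T i then w i t.2 else w i t.1.

Lemma iid_family_splice {d} {Omega : measurableType d} {I : finType} (T : pred I)
    (m : probability Omega R) (w : I -> Omega -> X) :
  iid_family m P w ->
  iid_family (m \x m)%E P (fun i t => splice T w t i).
Proof.
move=> pw; have pp := iid_family_prod m m w w pw pw.
have sI : injective (fun i : I => if T i then inr i else inl i : I + I).
  by move=> i j; case: ifP; case: ifP => // _ _ [].
have := iid_family_sub _ _ _ sI pp.
rewrite (_ : (fun j => _) = (fun i t => splice T w t i))//.
by apply/funext => i; apply/funext => t; rewrite /splice; case: ifP.
Qed.

(** The substitute for conditioning: resampling preserves the law, and the inner integral averages
    over the coordinates in [T] with the others frozen. *)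
Lemma integral_splice {d} {Omega : measurableType d} {I : finType} (T : pred I)
    (m : probability Omega R) (w : I -> Omega -> X) (f : family_space X I -> \bar R) :
  iid_family m P w -> measurable_fun setT f -> (forall x, 0 <= f x)%E ->
  (\int[m]_t f (w^~ t) = \int[m]_t \int[m]_t' f (splice T w (t, t')))%E.
Proof.
move=> pw mf f0; have ps := iid_family_splice T m w pw.
rewrite (iid_family_law_unique P m (m \x m)%E w _ f pw ps mf f0).
rewrite fubini_tonelli1//.
by apply: (measurableT_comp mf); apply: measurable_family; case: ps.
Qed.

End resampling.

(** * Moments of the trace of a sample Gram matrix *)

Lemma mxmeasurable_comp {R : realType} {d1 d2} {T1 : measurableType d1}
    {T2 : measurableType d2} {m n} (A : T2 -> 'M[R]_(m, n)) (f : T1 -> T2) :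
  mxmeasurable A -> measurable_fun setT f -> mxmeasurable (fun t => A (f t)).
Proof. by move=> mA mf i j; exact: (measurableT_comp (mA i j) mf). Qed.

Lemma integral_prob_cst {R : realType} {d} {T : measurableType d}
    (m : probability T R) (c : \bar R) : (\int[m]_t c = c)%E.
Proof.
rewrite integral_cst//; set q := (X in (_ * X)%E).
by have -> : q = 1%E := probability_setT m; rewrite mule1.
Qed.

Section sample_gram.
Context {R : realType} {dX : measure_display} {X : measurableType dX} {n : nat}.
Variable v : X -> 'cV[R]_n.

(** Columns outside [J] are zeroed rather than deleted, so every subsample has the same matrix type
    and a sample point is removed by passing to [J :\ j]. *)
Definition sample_mx (J : {set 'I_n}) (x : 'I_n -> X) : 'M[R]_n :=
  \matrix_(a, j) ((j \in J)%:R * v (x j) a 0).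

Definition sample_gram (J : {set 'I_n}) (x : 'I_n -> X) : 'M[R]_n :=
  sample_mx J x *m (sample_mx J x)^T.

Lemma sample_gramD1 (J : {set 'I_n}) (j : 'I_n) (x : 'I_n -> X) : j \in J ->
  sample_gram J x = sample_gram (J :\ j) x + v (x j) *m (v (x j))^T.
Proof.
move=> jJ; apply/matrixP => a b; rewrite !mxE big_ord1 (bigD1 j)//= !mxE jJ !mul1r.
rewrite [in RHS](bigD1 j)//= !mxE !inE eqxx !mul0r add0r addrC; congr (_ + _).
by apply: eq_bigr => k kj; rewrite !mxE !inE kj.
Qed.

(** Cyclicity of the trace: tr(V V^T S^q) = tr(V^T S^q V), whose diagonal entries are quadratic
    forms in the sample vectors. *)
Lemma trace_sample_gramS (J : {set 'I_n}) (q : nat) (x : 'I_n -> X) :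
  \tr (sample_gram J x ^+ q.+1) =
  \sum_(j in J) qform (sample_gram J x ^+ q) (v (x j)) (v (x j)).
Proof.
rewrite exprS -mulmxE {1}/sample_gram -mulmxA mxtrace_mulC -mulmxA.
rewrite [RHS]big_mkcond; apply: eq_bigr => j _.
have -> : ((sample_mx J x)^T *m (sample_gram J x ^+ q *m sample_mx J x)) j j =
    qform (sample_gram J x ^+ q) (col j (sample_mx J x)) (col j (sample_mx J x)).
  rewrite /qform -mulmxA !mxE; apply: eq_bigr => a _; rewrite !mxE; congr (_ * _).
  by apply: eq_bigr => b _; rewrite !mxE.
have -> : col j (sample_mx J x) = (j \in J)%:R *: v (x j).
  by apply/matrixP => a b; rewrite !mxE ord1.
case: (j \in J); first by rewrite scale1r.
by rewrite scale0r /qform mulmx0 mxE.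
Qed.

Lemma qform_sample_gram (J : {set 'I_n}) (x : 'I_n -> X) (u : 'cV[R]_n) :
  qform (sample_gram J x) u u = \sum_(j in J) (\sum_a v (x j) a 0 * u a 0) ^+ 2.
Proof.
rewrite qform_gram [RHS]big_mkcond; apply: eq_bigr => j _; rewrite -expr2 mxE.
case: ifPn => jJ; first by congr (_ ^+ 2); apply: eq_bigr => a _; rewrite !mxE jJ mul1r.
by rewrite big1 ?expr0n// => a _; rewrite !mxE (negbTE jJ) !mul0r.
Qed.

Lemma eq_sample_gram (J : {set 'I_n}) (x y : 'I_n -> X) :
  (forall j, j \in J -> x j = y j) -> sample_gram J x = sample_gram J y.
Proof.
move=> xy; rewrite /sample_gram; have -> // : sample_mx J x = sample_mx J y.
apply/matrixP => a j; rewrite !mxE; case: (boolP (j \in J)) => [/xy -> //|_].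
by rewrite !mul0r.
Qed.

Lemma trace_sample_gram_ge0 (J : {set 'I_n}) (q : nat) (x : 'I_n -> X) :
  0 <= \tr (sample_gram J x ^+ q).
Proof.
rewrite /sample_gram; have [W ->] := gram_pow (sample_mx J x) q.
rewrite mxtrace_gram; apply: sumr_ge0 => i _; apply: sumr_ge0 => j _.
exact: sqr_ge0.
Qed.

Hypothesis mv : mxmeasurable v.

Lemma mxmeasurable_sample_gram (J : {set 'I_n}) :
  mxmeasurable (fun x : family_space X 'I_n => sample_gram J x).
Proof.
have mV : mxmeasurable (fun x : family_space X 'I_n => sample_mx J x).
  apply: (@mxmeasurable_mx _ _ (family_space X 'I_n) _ _
    (fun a j x => (j \in J)%:R * v (x j) a 0)) => a j.
  apply: measurable_funM; first exact: measurable_cst.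
  exact: (measurableT_comp (mv a 0) (measurable_coord j)).
by apply: mxmeasurableM => //; exact: mxmeasurable_tr.
Qed.

Variable P : probability X R.
Variable g : R.
Hypothesis covg : forall u : 'cV[R]_n,
  (\int[P]_y ((\sum_a v y a 0 * u a 0) ^+ 2)%:E <= (g * sqnorm u)%:E)%E.

(** Along the columns of [W] the form is a sum of squares of linear functionals of [v y], to each of
    which [covg] applies; no matrix is ever integrated. *)
Lemma integral_qform_gram_le (W : 'M[R]_n) :
  (\int[P]_y (qform (W *m W^T) (v y) (v y))%:E <= (g * \tr (W *m W^T))%:E)%E.
Proof.
have mWv (i : 'I_n) : measurable_fun setT (fun y => (\sum_a v y a 0 * col i W a 0) ^+ 2).
  apply: measurable_funX; apply: measurable_sum => a.
  by apply: measurable_funM => //; exact: measurable_cst.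
have -> : \tr (W *m W^T) = \sum_i sqnorm (col i W).
  rewrite mxtrace_gram exchange_big; apply: eq_bigr => i _.
  by apply: eq_bigr => j _; rewrite mxE.
have -> : (fun y => (qform (W *m W^T) (v y) (v y))%:E) =
    (fun y => \sum_i ((\sum_a v y a 0 * col i W a 0) ^+ 2)%:E)%E.
  apply/funext => y; rewrite sumEFin; congr (_%:E); rewrite qform_gram.
  apply: eq_bigr => i _; rewrite -expr2 mxE; congr (_ ^+ 2).
  by apply: eq_bigr => a _; rewrite !mxE mulrC.
rewrite ge0_integral_sum//; last 2 first.
- by move=> i; apply/measurable_EFinP; exact: mWv.
- by move=> i y _; rewrite lee_fin sqr_ge0.
by rewrite mulr_sumr -sumEFin; apply: lee_sum => i _; exact: covg.
Qed.

Variable L : R.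
Hypothesis vL : forall y, sqnorm (v y) <= L.

Context {d : measure_display} {Omega : measurableType d}.
Variables (m : probability Omega R) (w : 'I_n -> Omega -> X).
Hypothesis pw : iid_family m P w.
Variables (p : nat) (M : R).
Hypotheses (g0 : 0 <= g) (L0 : 0 <= L).
Hypothesis gM : 2 * (expR 1 * n%:R * g) <= M.
Hypothesis LM : 2 * (p%:R * L) <= M.

Let measurable_trace (J : {set 'I_n}) (q : nat) :
  measurable_fun setT (fun t => (\tr (sample_gram J (w^~ t) ^+ q))%:E).
Proof.
apply/measurable_EFinP.
have := @measurable_mxtrace _ _ _ _ _ (mxmeasurableX _ q (mxmeasurable_sample_gram J)).
by move=> /measurableT_comp; apply; apply: measurable_family; case: pw.
Qed.

Let measurable_qform_sample (J : {set 'I_n}) (q : nat) (j : 'I_n) :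
  measurable_fun setT (fun x : family_space X 'I_n =>
    (qform (sample_gram J x ^+ q) (v (x j)) (v (x j)))%:E).
Proof.
apply/measurable_EFinP; apply: measurable_qform.
- by apply: mxmeasurableX; exact: mxmeasurable_sample_gram.
- exact: (mxmeasurable_comp v (fun x : family_space X 'I_n => x j) mv
    (measurable_coord j)).
- exact: (mxmeasurable_comp v (fun x : family_space X 'I_n => x j) mv
    (measurable_coord j)).
Qed.

(** As [j] is not in [J], the Gram matrix does not see coordinate [j]; resampling that coordinate
    alone reduces the claim to a fixed matrix. *)
Lemma integral_qform_resample (J : {set 'I_n}) (q : nat) (j : 'I_n) : j \notin J ->
  (\int[m]_t (qform (sample_gram J (w^~ t) ^+ q) (v (w j t)) (v (w j t)))%:E <=
   g%:E * \int[m]_t (\tr (sample_gram J (w^~ t) ^+ q))%:E)%E.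
Proof.
move=> jJ; pose f (x : family_space X 'I_n) :=
  (qform (sample_gram J x ^+ q) (v (x j)) (v (x j)))%:E.
have mf : measurable_fun setT f by exact: measurable_qform_sample.
have f0 x : (0 <= f x)%E by rewrite lee_fin qform_pow_ge0.
rewrite (integral_splice P (pred1 j) m w f pw mf f0).
rewrite -ge0_integralZl_EFin//; last by move=> t _; rewrite lee_fin trace_sample_gram_ge0.
have ps := iid_family_splice P (pred1 j) m w pw.
apply: ge0_le_integral_mu.
- apply: (measurable_fun_fubini_tonelli_F (fun t => f (splice (pred1 j) w t))) => //.
  by apply: (measurableT_comp mf); apply: measurable_family; case: ps.
- by apply: emeasurable_funM => //; exact: measurable_cst.
- by move=> t; apply: integral_ge0.
move=> t; have -> : (fun t' => f (splice (pred1 j) w (t, t'))) = (fun t' =>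
    (fun y => (qform (sample_gram J (w^~ t) ^+ q) (v y) (v y))%:E) (w j t')).
  apply/funext => t'; rewrite /f /splice/= eqxx (eq_sample_gram J _ (w^~ t))//.
  by move=> i iJ /=; case: eqVneq => // ij; rewrite -ij iJ in jJ.
rewrite (iid_family_marginal P m w j
  (fun y => (qform (sample_gram J (w^~ t) ^+ q) (v y) (v y))%:E) pw).
- rewrite /sample_gram; have [W ->] := gram_pow (sample_mx J (w^~ t)) q.
  by rewrite -EFinM; exact: integral_qform_gram_le.
- by apply/measurable_EFinP; apply: measurable_qform.
- by move=> y; rewrite lee_fin qform_pow_ge0.
Qed.

(** The induction covers all [J] at once because each step discards one sample point. The hypotheses
    [gM] and [LM] give half of [M] to each of the two terms of the rank-one bound, and the factor n
    is the trace of the identity at q = 0. *)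
Lemma trace_moment (q : nat) (J : {set 'I_n}) : (q <= p)%N ->
  (\int[m]_t (\tr (sample_gram J (w^~ t) ^+ q))%:E <= (n%:R * M ^+ q)%:E)%E.
Proof.
have M0 : 0 <= M by apply: le_trans LM; rewrite !mulr_ge0.
elim: q J => [|q ih] J qp.
  under eq_integral do rewrite expr0 mxtrace1.
  by rewrite expr0 mulr1 integral_prob_cst.
pose c := q.+1%:R ^+ q * L ^+ q.+1.
have c0 : 0 <= c by rewrite mulr_ge0 ?exprn_ge0.
pose f j t := (qform (sample_gram (J :\ j) (w^~ t) ^+ q) (v (w j t)) (v (w j t)))%:E.
have mf j : measurable_fun setT (f j).
  have := measurable_qform_sample (J :\ j) q j.
  by move=> /measurableT_comp; apply; apply: measurable_family; case: pw.
have f0 j t : (0 <= f j t)%E by rewrite lee_fin qform_pow_ge0.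
pose F j t := (if j \in J then (expR 1)%:E * f j t + c%:E else 0)%E.
have mF j : measurable_fun setT (F j).
  rewrite /F; case: (j \in J); last exact: measurable_cst.
  by apply: emeasurable_funD => //; apply: emeasurable_funM.
have F0 j t : (0 <= F j t)%E.
  rewrite /F; case: (j \in J) => //.
  apply: adde_ge0; last by rewrite lee_fin.
  by apply: mule_ge0; rewrite ?f0// lee_fin expR_ge0.
apply: (@le_trans _ _ (\int[m]_t \sum_(j < n) F j t)%E).
  apply: ge0_le_integral_mu => //.
  - exact: emeasurable_sum.
  - by move=> t; rewrite lee_fin trace_sample_gram_ge0.
  move=> t; rewrite trace_sample_gramS -sumEFin big_mkcond.
  apply: lee_sum => j _; rewrite /F; case: ifPn => // jJ.
  rewrite -EFinM -EFinD lee_fin {1}(sample_gramD1 J j (w^~ t) jJ).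
  apply: le_trans (qform_rank1_pow _ _ _ _ _ _) _.
  - by move=> i; rewrite -sample_gramD1//; exact: qform_pow_ge0.
  - by move=> i; exact: qform_pow_ge0.
  - by move=> i; exact: qform_pow_logconvex.
  by rewrite lerD2l ler_wpM2l ?exprn_ge0// lerXn2r ?nnegrE ?sqnorm_ge0.
rewrite ge0_integral_sum//.
have -> : n%:R * M ^+ q.+1 = \sum_(j < n) M ^+ q.+1 by rewrite sumr_const card_ord mulr_natl.
rewrite -sumEFin; apply: lee_sum => j _; rewrite /F; case: (boolP (j \in J)) => jJ.
  2: by rewrite integral0 lee_fin exprn_ge0.
rewrite ge0_integralD//; last 2 first.
- by move=> t _; apply: mule_ge0; rewrite ?f0// lee_fin expR_ge0.
- by apply: emeasurable_funM.
rewrite integral_prob_cst ge0_integralZl_EFin ?expR_ge0//.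
apply: (@le_trans _ _ ((expR 1)%:E * (g%:E * (n%:R * M ^+ q)%:E) + c%:E)%E).
  rewrite leeD2r// lee_wpmul2l ?lee_fin ?expR_ge0//.
  apply: le_trans (integral_qform_resample (J :\ j) q j _) _; first by rewrite !inE eqxx.
  by rewrite lee_wpmul2l ?lee_fin// ih// ltnW.
rewrite -!EFinM -EFinD lee_fin.
have Mq : 0 <= M ^+ q by rewrite exprn_ge0.
have h1 : expR 1 * (g * (n%:R * M ^+ q)) <= M ^+ q.+1 / 2.
  rewrite exprS ler_pdivlMr//.
  have -> : expR 1 * (g * (n%:R * M ^+ q)) * 2 = 2 * (expR 1 * n%:R * g) * M ^+ q by ring.
  by rewrite ler_wpM2r.
(* Split 2c as ((q+1) L)^q times 2L; since q + 1 <= p, each of the q + 1 factors is at most [M]. *)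
have h2 : c <= M ^+ q.+1 / 2.
  rewrite ler_pdivlMr//.
  have -> : c * 2 = (q.+1%:R * L) ^+ q * (2 * L) by rewrite /c exprMn exprS; ring.
  have qL : q.+1%:R * L <= M.
    apply: le_trans LM; apply: (@le_trans _ _ (p%:R * L)).
      by rewrite ler_wpM2r// ler_nat.
    by rewrite ler_peMl ?mulr_ge0// ler1n.
  rewrite exprSr ler_pM ?exprn_ge0 ?mulr_ge0//.
    by rewrite lerXn2r ?nnegrE ?mulr_ge0.
  apply: le_trans LM; rewrite ler_wpM2l// ler_peMl// ler1n.
  exact: leq_trans qp.
by apply: le_trans (lerD h1 h2) _; rewrite -splitr.
Qed.

End sample_gram.

(** * Rudelson's inequality *)

Section rudelson_inequality.
Context {R : realType} {dX : measure_display} {X : measurableType dX} {n : nat}.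
Variable P : probability X R.
Context {d : measure_display} {Omega : measurableType d}.
Variables (m : probability Omega R) (w : 'I_n -> Omega -> X).
Hypothesis pw : iid_family m P w.

(* Markov leaves a probability at least 1/2 that every other [h (w i)] is below
   [2 l], and on this event the large value is the maximum. *)
Lemma integral_large_values_le (h : X -> R) (l : R) :
  measurable_fun setT h -> (forall y, 0 <= h y) -> 0 < l ->
  (\int[m]_t (\big[Num.max/0]_(i < n) h (w i t))%:E <= l%:E)%E ->
  (\int[m]_t (\sum_(j < n) (if 2 * l < h (w j t) then h (w j t) else 0))%:E
    <= (2 * l)%:E)%E.
Proof.
move=> mh h0 l0 maxl; have [mw _] := pw.
pose L := 2 * l; have L0 : 0 < L by rewrite mulr_gt0.
have mhL : measurable_fun setT (fun y => if L < h y then h y else 0).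
  apply: measurable_fun_ifT => //.
  by apply: measurable_fun_ltr => //; exact: measurable_cst.
pose T y := if L < h y then h y else 0; rewrite -/L -/(T _).
have T0 y : 0 <= T y by rewrite /T; case: ifP.
(* The event ignores coordinate [j] itself, so it is independent of [h (w j)] and the two factor
   after resampling [j]. *)
pose B (x : family_space X 'I_n) (j : 'I_n) := [forall i, (i != j) ==> (h (x i) <= L)].
have mB j : measurable_fun setT (fun x => (B x j)%:R : R).
  have -> : (fun x => (B x j)%:R : R) = (fun x : family_space X 'I_n =>
      \prod_(i < n) (if (i != j) ==> (h (x i) <= L) then 1 else 0)).
    apply/funext => x; rewrite /B; case: (boolP [forall i, _]) => [/forallP hB|].
      by rewrite big1// => i _; rewrite hB.
    by rewrite negb_forall => /existsP[i hi]; rewrite (bigD1 i)//= (negbTE hi) mul0r.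
  apply: measurable_prod => i _; apply: measurable_fun_ifT; try exact: measurable_cst.
  case: (i != j) => /=; last exact: measurable_cst.
  apply: measurable_fun_ler; last exact: measurable_cst.
  exact: (measurableT_comp mh (measurable_coord i)).
pose H t := \big[Num.max/0]_(i < n) h (w i t).
have mH : measurable_fun setT H.
  by apply: measurable_bigmax => i; exact: (measurableT_comp mh (mw i)).
have hH i t : h (w i t) <= H t by exact: (le_bigmax _ (fun i => h (w i t))).
have H0 t : 0 <= H t.
  exact: bigmax_ge_id.
have mW := measurable_family w mw.
have half j : ((2^-1)%:E <= \int[m]_t ((B (w^~ t) j)%:R)%:E)%E.
  have mBw : measurable_fun setT (fun t => ((B (w^~ t) j)%:R : R)%:E).
    by apply/measurable_EFinP; exact: (measurableT_comp (mB j) mW).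
  have mHL : measurable_fun setT (fun t => (L^-1)%:E * (H t)%:E)%E.
    by apply: emeasurable_funM => //; exact/measurable_EFinP.
  (* Pointwise, either the maximum [H] is at most [L] and the event holds, or H / L exceeds 1; and H
     / L has expectation at most l / (2 l). *)
  have : (1 <= \int[m]_t ((B (w^~ t) j)%:R)%:E + (2^-1)%:E)%E.
    apply: (@le_trans _ _ (\int[m]_t (((B (w^~ t) j)%:R)%:E + (L^-1)%:E * (H t)%:E))%E).
      rewrite -[leLHS](integral_prob_cst m); apply: ge0_le_integral_mu => //.
      - exact: emeasurable_funD.
      - move=> t; rewrite -EFinM -EFinD lee_fin.
        have [HL|HL] := leP (H t) L.
          have -> : B (w^~ t) j = true.
            by apply/forallP => i; apply/implyP => _; rewrite (le_trans (hH i t)).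
          by rewrite lerDl mulr_ge0// invr_ge0 ltW.
        by rewrite ler_wpDl// ler_pdivlMl// mulr1 ltW.
    rewrite ge0_integralD//; last by move=> t _; rewrite -EFinM lee_fin mulr_ge0// invr_ge0 ltW.
    rewrite leeD2l// ge0_integralZl_EFin ?invr_ge0 ?(ltW L0)//; last 2 first.
    - by move=> t _; rewrite lee_fin.
    - exact/measurable_EFinP.
    apply: (@le_trans _ _ ((L^-1)%:E * l%:E)%E).
      by rewrite lee_wpmul2l// lee_fin invr_ge0 ltW.
    by rewrite -EFinM lee_fin /L invfM -mulrA mulVf ?mulr1// gt_eqF.
  rewrite -leeBlDr//; apply: le_trans.
  by rewrite -EFinB lee_fin {2}(splitr 1) mul1r; lra.
pose f j (x : family_space X 'I_n) := ((T (x j) * (B x j)%:R)%:E : \bar R).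
have mf j : measurable_fun setT (f j).
  apply/measurable_EFinP; apply: measurable_funM => //.
  exact: (measurableT_comp mhL (measurable_coord j)).
have f0 j x : (0 <= f j x)%E by rewrite lee_fin mulr_ge0.
have mTw j : measurable_fun setT (fun t => (T (w j t))%:E).
  by apply/measurable_EFinP; exact: (measurableT_comp mhL (mw j)).
have key j : ((2^-1)%:E * \int[m]_t (T (w j t))%:E <= \int[m]_t f j (w^~ t))%E.
  rewrite (integral_splice P (pred1 j) m w (f j) pw (mf j) (f0 j)).
  have -> : (fun t => \int[m]_t' f j (splice (pred1 j) w (t, t')))%E =
      (fun t => (\int[m]_t' (T (w j t'))%:E) * ((B (w^~ t) j)%:R)%:E)%E.
    apply/funext => t; rewrite muleC -ge0_integralZl_EFin//; last first.
      by move=> t' _; rewrite lee_fin.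
    apply: eq_integral => t' _; rewrite /f /splice/= eqxx -EFinM mulrC.
    congr ((_ * _)%:E); congr ((nat_of_bool _)%:R).
    by apply: eq_forallb => i; case: (i == j).
  have I0 : (0 <= \int[m]_t (T (w j t))%:E)%E.
    by apply: integral_ge0 => t _; rewrite lee_fin.
  have mBw : measurable_fun setT (fun t => ((B (w^~ t) j)%:R : R)%:E).
    by apply/measurable_EFinP; exact: (measurableT_comp (mB j) mW).
  have B0 t : setT t -> (0 <= ((B (w^~ t) j)%:R : R)%:E)%E by rewrite lee_fin.
  rewrite ge0_integralZl// muleC; apply: lee_wpmul2l => //; exact: half.
(* At most one index [j] can have a value above [L] with all the others below it, so the sum has at
   most one nonzero term, bounded by the maximum. *)
have total : (\sum_(j < n) \int[m]_t f j (w^~ t) <= l%:E)%E.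
  have mfw j : measurable_fun setT (fun t => f j (w^~ t)) := measurableT_comp (mf j) mW.
  rewrite -ge0_integral_sum//; apply: le_trans maxl; apply: ge0_le_integral_mu.
  - exact: emeasurable_sum.
  - exact/measurable_EFinP.
  - by move=> t; apply: sume_ge0.
  move=> t; rewrite /f sumEFin lee_fin -/(H t).
  have [/existsP[j /andP[jL jB]]|/existsPn hN] :=
      boolP [exists j, (L < h (w j t)) && B (w^~ t) j].
    rewrite (bigD1 j)//= big1 ?addr0.
      by rewrite /T jL jB mulr1.
    move=> i ij; rewrite /T; case: ifP => [iL|_]; last by rewrite mul0r.
    by move/forallP : jB => /(_ i); rewrite ij/= leNgt iL.
  rewrite big1// => j _; have := hN j; rewrite negb_and /T.
  by case: (L < h (w j t)) => [/= /negbTE ->|_]; rewrite ?mulr0 ?mul0r.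
under eq_integral do rewrite -sumEFin.
rewrite ge0_integral_sum//; last by move=> j t _; rewrite lee_fin; exact: T0.
have : ((2^-1)%:E * \sum_(j < n) \int[m]_t (T (w j t))%:E <= l%:E)%E.
  apply: le_trans total; rewrite ge0_sume_distrr; first by apply: lee_sum => j _.
  by move=> j _; apply: integral_ge0 => t _; rewrite lee_fin.
have -> : (2 * l)%:E = (2%:E * l%:E)%E by [].
rewrite -(@lee_pmul2l _ 2%:E)//= ?lte_fin//.
by rewrite muleA -EFinM divff// mul1e.
Qed.

Lemma rudelson (v : X -> 'cV[R]_n) (g l : R) (p : nat) :
  mxmeasurable v -> 0 <= g -> 0 < l ->
  (forall u : 'cV[R]_n,
    (\int[P]_y ((\sum_a v y a 0 * u a 0) ^+ 2)%:E <= (g * sqnorm u)%:E)%E) ->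
  (\int[m]_t (\big[Num.max/0]_(i < n) sqnorm (v (w i t)))%:E <= l%:E)%E ->
  (n <= 2 ^ p)%N ->
  (\int[m]_t (opn (\matrix_(i, j) v (w i t) j 0) ^+ 2)%:E <=
    (6 * expR 1 * n%:R * g + 14 * p.+1%:R * l)%:E)%E.
Proof.
move=> mv g0 l0 covg maxl np; have [mw _] := pw; have mW := measurable_family w mw.
pose L := 2 * l; have L0 : 0 < L by rewrite mulr_gt0.
pose v' y := if sqnorm (v y) <= L then v y else 0.
have msq : measurable_fun setT (fun y => sqnorm (v y)) by exact: measurable_sqnorm.
have mb : measurable_fun setT (fun y => sqnorm (v y) <= L).
  by apply: measurable_fun_ler => //; exact: measurable_cst.
have mv' : mxmeasurable v'.
  move=> a b; have -> : (fun y => v' y a b) =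
      (fun y => if sqnorm (v y) <= L then v y a b else 0).
    by apply/funext => y; rewrite /v'; case: ifP => // _; rewrite mxE.
  by apply: measurable_fun_ifT.
have v'L y : sqnorm (v' y) <= L.
  rewrite /v'; case: ifP => // _; rewrite /sqnorm big1 ?ltW// => a _.
  by rewrite mxE expr0n.
have mdot (v0 : X -> 'cV[R]_n) (u : 'cV[R]_n) : mxmeasurable v0 ->
    measurable_fun setT (fun y => ((\sum_a v0 y a 0 * u a 0) ^+ 2)%:E).
  move=> mv0; apply/measurable_EFinP; apply: measurable_funX.
  apply: measurable_sum => a; apply: measurable_funM; [exact: mv0|exact: measurable_cst].
(* Truncation replaces some vectors by zero, which can only lower the second moments. *)
have covg' (u : 'cV[R]_n) :
    (\int[P]_y ((\sum_a v' y a 0 * u a 0) ^+ 2)%:E <= (g * sqnorm u)%:E)%E.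
  apply: le_trans (covg u); apply: ge0_le_integral_mu; try exact: mdot.
    by move=> y; rewrite lee_fin sqr_ge0.
  move=> y; rewrite lee_fin /v'; case: ifP => // _.
  by rewrite big1 ?expr0n ?sqr_ge0// => a _; rewrite mxE mul0r.
(* The sum of the two lower bounds that [trace_moment] asks of [M], for moments up to order p +
   1. *)
pose M := 2 * (expR 1 * n%:R * g) + 2 * (p.+1%:R * L).
have eng0 : 0 <= expR 1 * n%:R * g by rewrite !mulr_ge0 ?expR_ge0.
have pL0 : 0 < p.+1%:R * L by rewrite mulr_gt0.
have M0 : 0 < M by apply: ltr_wpDl; [exact: mulr_ge0|exact: mulr_gt0].
have gM : 2 * (expR 1 * n%:R * g) <= M by rewrite /M; lra.
have LM : 2 * (p.+1%:R * L) <= M by rewrite /M; lra.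
pose full : {set 'I_n} := [set: 'I_n]%SET.
have tm := trace_moment v' mv' P g covg' L v'L m w pw p.+1 M g0 (ltW L0) gM LM p.+1 full (leqnn _).
pose S t := sample_gram v' full (w^~ t).
pose Tl t := \sum_(j < n) (if L < sqnorm (v (w j t)) then sqnorm (v (w j t)) else 0).
have tail : (\int[m]_t (Tl t)%:E <= (2 * l)%:E)%E.
  exact: (integral_large_values_le (fun y => sqnorm (v y)) l msq
    (fun y => sqnorm_ge0 _) l0 maxl).
have Tl0 t : 0 <= Tl t.
  by apply: sumr_ge0 => j _; case: ifP => // _; exact: sqnorm_ge0.
have mTl : measurable_fun setT (fun t => (Tl t)%:E).
  apply/measurable_EFinP; apply: measurable_sum => j.
  have mj : measurable_fun setT (fun t => sqnorm (v (w j t))).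
    exact: (measurableT_comp msq (mw j)).
  apply: measurable_fun_ifT => //.
  by apply: measurable_fun_ltr => //; exact: measurable_cst.
have tr0 t : 0 <= \tr (S t ^+ p.+1) by exact: trace_sample_gram_ge0.
have mtr : measurable_fun setT (fun t => (\tr (S t ^+ p.+1))%:E).
  apply/measurable_EFinP.
  have := measurable_mxtrace _ (mxmeasurableX _ p.+1 (mxmeasurable_sample_gram v' mv' full)).
  by move=> /measurableT_comp; apply.
have M2p : 0 < (2 * M) ^+ p by rewrite exprn_gt0// mulr_gt0.
(* A majorant from [qform_gram_le] taken at [2 * M]: the doubling puts 2^p >= n in the denominator,
   which absorbs the n of the trace moment. *)
pose Z t := ((2 * M)%:E + (((2 * M) ^- p)%:E * (\tr (S t ^+ p.+1))%:E + (Tl t)%:E))%E.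
have mx : mxmeasurable (fun t => \matrix_(i, j) v (w i t) j 0 : 'M[R]_n).
  by apply: mxmeasurable_mx => i j; exact: (measurableT_comp (mv j 0) (mw i)).
apply: (@le_trans _ _ (\int[m]_t Z t)%E).
  apply: ge0_le_integral_mu.
  - apply/measurable_EFinP; apply: measurable_funX; exact: measurable_opn.
  - apply: emeasurable_funD => //.
    by apply: emeasurable_funD => //; apply: emeasurable_funM.
  - by move=> t; rewrite lee_fin sqr_ge0.
  move=> t; rewrite /Z -EFinM -!EFinD lee_fin; apply: opn_sqr_le.
    by rewrite !addr_ge0 ?mulr_ge0 ?invr_ge0 ?(ltW M2p)// ltW.
  move=> u.
  have -> : sqnorm ((\matrix_(i, j) v (w i t) j 0) *m u) =
      \sum_i (\sum_a v (w i t) a 0 * u a 0) ^+ 2.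
    apply: eq_bigr => i _; rewrite mxE; congr (_ ^+ 2).
    by apply: eq_bigr => a _; rewrite mxE.
  (* Index by index: a vector below the cutoff enters [S], one above it is bounded by Cauchy-Schwarz
     and enters [Tl]. *)
  apply: (@le_trans _ _ (qform (S t) u u + Tl t * sqnorm u)).
    rewrite qform_sample_gram mulr_suml [X in X + _]big_mkcond -big_split/=.
    apply: ler_sum => i _; rewrite inE /v'; have [hi|hi] := leP (sqnorm (v (w i t))) L.
      by rewrite mul0r addr0.
    rewrite [X in X ^+ 2 + _]big1 ?expr0n ?add0r; last by move=> a _; rewrite mxE mul0r.
    exact: (sum_cauchy_schwarz (fun a => v (w i t) a 0) (fun a => u a 0)).
  rewrite addrA mulrDl lerD2r mulrC.
  have M20 : 0 < 2 * M by rewrite mulr_gt0.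
  have := @qform_gram_le _ _ (sample_mx v' full (w^~ t)) u (2 * M) p M20.
  by rewrite [\tr _ / _]mulrC.
rewrite /Z ge0_integralD//; last 3 first.
- by move=> t _; rewrite lee_fin mulr_ge0// ltW.
- by move=> t _; rewrite -EFinM -EFinD lee_fin addr_ge0// mulr_ge0// invr_ge0 ltW.
- by apply: emeasurable_funD => //; apply: emeasurable_funM.
rewrite integral_prob_cst ge0_integralD//; last 3 first.
- by move=> t _; rewrite -EFinM lee_fin mulr_ge0// invr_ge0 ltW.
- by apply: emeasurable_funM.
- by move=> t _; rewrite lee_fin.
rewrite ge0_integralZl_EFin ?invr_ge0 ?(ltW M2p)//; last by move=> t _; rewrite lee_fin.
apply: (@le_trans _ _ ((2 * M)%:E + (((2 * M) ^- p)%:E * (n%:R * M ^+ p.+1)%:E + (2 * l)%:E))%E).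
  rewrite leeD2l// leeD// lee_wpmul2l// lee_fin invr_ge0 ltW//.
rewrite -EFinM -!EFinD lee_fin.
have hn : (2 * M) ^- p * (n%:R * M ^+ p.+1) <= M.
  have e : (2 * M) ^+ p * M = 2 ^+ p * M ^+ p.+1 by rewrite exprMn exprSr mulrA.
  by rewrite ler_pdivrMl// e ler_wpM2r ?exprn_ge0 ?(ltW M0)// -natrX ler_nat.
(* Since L = 2 l, the total 3 M + 2 l equals 6 e n g + 12 (p+1) l + 2 l, whence the constants 6 e
   and 14. *)
apply: le_trans (_ : 2 * M + (M + 2 * l) <= _); first by rewrite lerD2l lerD2r.
have lp : l <= p.+1%:R * l by rewrite ler_peMl ?(ltW l0)// ler1n.
rewrite /M /L; nra.
Qed.

End rudelson_inequality.

(** * Covariance and decoupling *)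

Section covariance.
Context {R : realType} {d : measure_display} {T : measurableType d}.
Variable P : probability T R.

Let L1 (f : T -> R) := P.-integrable setT (EFin \o f).

Lemma integrable_rsum {I : Type} (r : seq I) (f : I -> T -> R) :
  (forall i, L1 (f i)) -> L1 (fun t => \sum_(i <- r) f i t).
Proof.
move=> fi; have := @integrable_sum _ _ _ P setT measurableT I r xpredT (fun i t => (f i t)%:E).
move=> /(_ (fun i _ => fi i)); apply: eq_integrable => // t _ /=.
by rewrite sumEFin.
Qed.

Lemma Rintegral_sum {I : Type} (r : seq I) (f : I -> T -> R) :
  (forall i, L1 (f i)) ->
  Rintegral P setT (fun t => \sum_(i <- r) f i t) =
  \sum_(i <- r) Rintegral P setT (f i).
Proof.
move=> fi; elim: r => [|i r ih].
  rewrite big_nil; under eq_Rintegral do rewrite big_nil.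
  by rewrite /Rintegral integral0.
rewrite big_cons -ih -RintegralD//; [|exact: fi|exact: integrable_rsum].
by apply: eq_Rintegral => t _; rewrite big_cons.
Qed.

Lemma integrable_rZ (c : R) (f : T -> R) : L1 f -> L1 (fun t => c * f t).
Proof. by move=> fi; have := integrableZl measurableT c fi; exact: eq_integrable. Qed.

(** A variance is at most the second moment: for F = sum_a u_a q_a with mean c, the left side is E
    F^2 - c^2. Finite second moments on a probability space make every integral involved finite. *)
Lemma covariance_qform_le {n : nat} (q : 'I_n -> T -> R) (u : 'cV[R]_n) :
  (forall i, measurable_fun setT (q i)) ->
  (forall i, (\int[P]_y (q i y * q i y)%:E < +oo)%E) ->
  (\int[P]_y ((\sum_a (q a y - Rintegral P setT (q a)) * u a 0) ^+ 2)%:E <=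
   (qform (\matrix_(i, j) Rintegral P setT (fun y => q i y * q j y)) u u)%:E)%E.
Proof.
move=> mq q2.
have q2i i : L1 (fun y => q i y * q i y).
  apply/integrableP; split; first by apply/measurable_EFinP; exact: measurable_funM.
  apply: le_lt_trans (q2 i); apply: ge0_le_integral_mu => //.
  - by apply: measurableT_comp => //; apply/measurable_EFinP; exact: measurable_funM.
  - by apply/measurable_EFinP; exact: measurable_funM.
  - by move=> t /=; rewrite lee_fin ger0_norm// -expr2 sqr_ge0.
have qqi i j : L1 (fun y => q i y * q j y).
  have s : L1 (fun y => q i y * q i y + q j y * q j y).
    by have := integrableD measurableT (q2i i) (q2i j); exact: eq_integrable.
  apply: (le_integrable measurableT _ _ s).
  - by apply/measurable_EFinP; exact: measurable_funM.
  - move=> t _ /=; rewrite lee_fin [leRHS]ger0_norm; last by rewrite -!expr2 addr_ge0 ?sqr_ge0.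
    by rewrite ler_norml; apply/andP; split; nra.
have qi i : L1 (q i).
  have s : L1 (fun y => 1 + q i y * q i y).
    have c1 : L1 (fun=> 1) by exact: finite_measure_integrable_cst.
    by have := integrableD measurableT c1 (q2i i); exact: eq_integrable.
  apply: (le_integrable measurableT _ _ s).
  - exact/measurable_EFinP.
  - move=> t _ /=; rewrite lee_fin [leRHS]ger0_norm; last by rewrite -expr2 addr_ge0 ?sqr_ge0.
    by rewrite ler_norml; apply/andP; split; nra.
pose F y := \sum_a u a 0 * q a y.
have Fi : L1 F by apply: integrable_rsum => a; exact: integrable_rZ.
pose c := Rintegral P setT F.
have cE : c = \sum_a u a 0 * Rintegral P setT (q a).
  rewrite /c Rintegral_sum => [|a]; last exact: integrable_rZ.
  by apply: eq_bigr => a _; rewrite RintegralZl//; exact: qi.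
pose F2 y := \sum_a \sum_b (u a 0 * u b 0) * (q a y * q b y).
have F2E y : F2 y = F y ^+ 2.
  rewrite expr2 big_distrlr/=; apply: eq_bigr => a _; apply: eq_bigr => b _.
  by rewrite mulrACA.
have F2i : L1 F2.
  by apply: integrable_rsum => a; apply: integrable_rsum => b; exact: integrable_rZ.
have F2int : Rintegral P setT F2 =
    qform (\matrix_(i, j) Rintegral P setT (fun y => q i y * q j y)) u u.
  rewrite Rintegral_sum => [|a]; last by apply: integrable_rsum => b; exact: integrable_rZ.
  rewrite /qform -mulmxA mxE; apply: eq_bigr => a _; rewrite !mxE mulr_sumr.
  rewrite Rintegral_sum => [|b]; last exact: integrable_rZ.
  apply: eq_bigr => b _; rewrite RintegralZl//; last exact: qqi.
  rewrite !mxE.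
  by rewrite [in RHS](mulrC _ (u b 0)) mulrA.
have Fc y : (\sum_a (q a y - Rintegral P setT (q a)) * u a 0) ^+ 2 =
    F2 y + (c ^+ 2 + (- (2 * c)) * F y).
  have -> : \sum_a (q a y - Rintegral P setT (q a)) * u a 0 = F y - c.
    by rewrite cE -sumrB; apply: eq_bigr => a _; rewrite mulrC mulrBr.
  by rewrite F2E; ring.
have ci : L1 (fun=> c ^+ 2) by exact: finite_measure_integrable_cst.
have li : L1 (fun y => c ^+ 2 + (- (2 * c)) * F y).
  by have := integrableD measurableT ci (integrable_rZ (- (2 * c)) F Fi); exact: eq_integrable.
have ti : L1 (fun y => F2 y + (c ^+ 2 + (- (2 * c)) * F y)).
  by have := integrableD measurableT F2i li; exact: eq_integrable.
under eq_integral do rewrite Fc.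
rewrite -[leLHS]fineK; last exact: (integrable_fin_num measurableT ti).
rewrite lee_fin -/(Rintegral P setT _) RintegralD// F2int.
rewrite RintegralD//; last exact: integrable_rZ.
rewrite [X in _ + (_ + X) <= _]RintegralZl// -/c.
have -> : Rintegral P setT (fun=> c ^+ 2) = c ^+ 2.
  by rewrite /Rintegral integral_prob_cst.
by nra.
Qed.

End covariance.

(** * Decoupling by averaging over index sets *)

Section decoupling.
Context {R : realType} {n : nat}.

Lemma card_set_natr : #|{: {set 'I_n}}|%:R = 2 ^+ n :> R.
Proof.
symmetry; rewrite -natrX -{1}(card_ord n) -cardsT -card_powerset; congr (_%:R).
by apply: eq_card => T; rewrite !inE finset.subsetT.
Qed.

(** Toggling the membership of [i], or of [j], is an involution on subsets; hence the four
    membership patterns are equally frequent. *)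
Lemma sum_separating_sets (i j : 'I_n) : i != j ->
  \sum_(T : {set 'I_n}) ((i \in T) && (j \notin T))%:R * 4 = 2 ^+ n :> R.
Proof.
move=> ij.
pose toggle (a : 'I_n) (T : {set 'I_n}) := [set x | (x \in T) (+) (x == a)]%SET.
have tK a : involutive (toggle a).
  by move=> T; apply/setP => x; rewrite !inE -addbA addbb addbF.
pose F (bi bj : bool) (T : {set 'I_n}) : R := (((i \in T) == bi) && ((j \in T) == bj))%:R.
have tog a (f : {set 'I_n} -> R) : \sum_T f T = \sum_T f (toggle a T).
  by rewrite (reindex_inj (inv_inj (tK a))).
have Fi bi bj : \sum_T F bi bj T = \sum_T F (~~ bi) bj T.
  rewrite (tog i); apply: eq_bigr => T _; rewrite /F !inE eqxx (eq_sym j) (negbTE ij).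
  by case: (i \in T); case: (j \in T); case: bi; case: bj.
have Fj bi bj : \sum_T F bi bj T = \sum_T F bi (~~ bj) T.
  rewrite (tog j); apply: eq_bigr => T _; rewrite /F !inE eqxx (negbTE ij).
  by case: (i \in T); case: (j \in T); case: bi; case: bj.
rewrite -mulr_suml.
have -> : \sum_(T : {set 'I_n}) ((i \in T) && (j \notin T))%:R = \sum_T F true false T.
  by apply: eq_bigr => T _; rewrite /F; case: (i \in T); case: (j \in T).
have -> : (2 ^+ n : R) = \sum_(T : {set 'I_n}) 1 by rewrite sumr_const card_set_natr.
have -> : \sum_(T : {set 'I_n}) (1 : R) =
  \sum_T F true false T + \sum_T F true true T +
  \sum_T F false false T + \sum_T F false true T.
  rewrite -!big_split/=; apply: eq_bigr => T _; rewrite /F.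
  by case: (i \in T); case: (j \in T); rewrite /= ?(addr0, add0r).
rewrite (Fj true true)/= (Fi false false)/= (Fi false true)/= (Fj true true)/=.
by ring.
Qed.

(* Averaging over all subsets T: an off-diagonal entry (i, j) has i in T and
   j outside of T for a quarter of the sets. *)
Lemma opn_decoupling (A : 'M[R]_n) (D : R) : (forall i, `|A i i| <= D) -> 0 <= D ->
  opn A <= D + 4 / 2 ^+ n * \sum_(T : {set 'I_n})
    opn (\matrix_(i, j) (((i \in T) && (j \notin T))%:R * A i j)).
Proof.
move=> AD D0.
pose B (T : {set 'I_n}) := \matrix_(i, j) (((i \in T) && (j \notin T))%:R * A i j).
have n2 : (2 ^+ n : R) != 0 by rewrite expf_neq0.
have AE : A = \matrix_(i, j) ((i == j)%:R * A i i) + (4 / 2 ^+ n) *: \sum_T B T.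
  apply/matrixP => i j; rewrite !mxE summxE.
  have [->|ij] := eqVneq i j.
    rewrite mul1r big1 ?mulr0 ?addr0// => T _; rewrite mxE.
    by case: (j \in T); rewrite mul0r.
  rewrite mul0r add0r.
  under eq_bigr do rewrite mxE.
  rewrite -mulr_suml mulrA -[LHS]mul1r; congr (_ * _).
  by rewrite mulrAC -mulrAC mulrC mulrA mulr_suml sum_separating_sets// divff.
rewrite [X in opn X]AE (le_trans (opnD _ _))// lerD//.
  by rewrite -[leRHS]ger0_norm//; exact: opn_diag.
have c0 : 0 <= 4 / 2 ^+ n :> R by rewrite divr_ge0// exprn_ge0.
apply: le_trans (opnZ _ _ c0) _; by apply: ler_wpM2l => //; exact: opn_sum.
Qed.

End decoupling.

(** * Kernel matrices *)

Lemma measurable_forallb {d} {T : measurableType d} {I : finType} (b : I -> T -> bool) :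
  (forall i, measurable_fun setT (b i)) ->
  measurable_fun setT (fun t => [forall i, b i t]).
Proof.
move=> mb; apply: (measurable_fun_bool true); rewrite setTI.
have -> : (fun t => [forall i, b i t]) @^-1` [set true] =
    \bigcap_(i in [set: I]) (b i @^-1` [set true]).
  apply/seteqP; split=> t /=; first by move=> /forallP h i _; exact: h.
  by move=> h; apply/forallP => i; exact: h.
apply: fin_bigcap_measurable => [|i _]; first exact: finite_finset.
by rewrite -[X in measurable X]setTI; exact: mb.
Qed.

Section parametric.
Context {R : realType} {d dX : measure_display} {T : measurableType d}
  {X : measurableType dX}.
Variable P : probability X R.

Lemma measurable_ge0_integral_param (f : T * X -> R) :
  measurable_fun setT f -> (forall u, 0 <= f u) ->
  measurable_fun setT (fun s => \int[P]_y (f (s, y))%:E)%E.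
Proof.
move=> mf f0; apply: (measurable_fun_fubini_tonelli_F (fun u => (f u)%:E)) => //.
exact/measurable_EFinP.
Qed.

(** Tonelli applies to the positive and negative parts separately, so the claim includes parameters
    where the integral diverges and [fine] yields its default. *)
Lemma measurable_Rintegral_param (f : T * X -> R) :
  measurable_fun setT f ->
  measurable_fun setT (fun s => Rintegral P setT (fun y => f (s, y))).
Proof.
move=> mf; have mfe : measurable_fun setT (EFin \o f) by exact/measurable_EFinP.
have -> : (fun s => Rintegral P setT (fun y => f (s, y))) = (fun s =>
    fine (\int[P]_y ((EFin \o f)^\+ (s, y)) - \int[P]_y ((EFin \o f)^\- (s, y))))%E.
  apply/funext => s; rewrite /Rintegral integralE.
  by congr (fine (_ - _)%E); apply: eq_integral => y _; rewrite ?funeposE ?funenegE.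
apply: (@measurableT_comp _ _ _ _ _ _ fine _ (fun s =>
  \int[P]_y ((EFin \o f)^\+ (s, y)) - \int[P]_y ((EFin \o f)^\- (s, y)))%E).
  exact: fine_measurable.
apply: emeasurable_funB; apply: measurable_fun_fubini_tonelli_F => //.
- exact: measurable_funepos.
- exact: measurable_funeneg.
Qed.

End parametric.

Lemma sume_cst_ord {R : realDomainType} (n : nat) (c : \bar R) : (0 <= c)%E ->
  (\sum_(j < n) c = n%:R%:E * c)%E.
Proof.
move=> c0; elim: n => [|n ih]; first by rewrite big_ord0 mul0e.
by rewrite big_ord_recr/= ih -natr1 EFinD ge0_muleDl// mul1e.
Qed.

Section kernel.
Context {R : realType} {d dX : measure_display} {Omega : measurableType d}
  {X : measurableType dX} {n : nat}.
Variables (P0 : probability Omega R) (P : probability X R) (k : X -> X -> R).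
Variables (z : Omega -> X) (x : 'I_n -> Omega -> X).
Hypothesis mk : measurable_fun setT (fun p : X * X => k p.1 p.2).
Hypothesis ksym : forall y y', k y y' = k y' y.
Hypothesis iid : iid_sample P0 P z x.

Let m (y : X) : R := Rintegral P setT (fun t => k y t).

(** The rows are random through [y], the columns frozen at [xs]; by symmetry of [k], [m (xs j)] is
    the mean of an entry of column j over the row point. *)
Definition centered_kmat (y xs : 'I_n -> X) : 'M[R]_n :=
  \matrix_(i, j) (k (y i) (xs j) - m (xs j)).

Let law_x : iid_family P0 P x.
Proof.
exact: (@iid_family_sub _ _ _ P _ _ (option 'I_n) 'I_n P0 _ Some Some_inj iid).
Qed.

Let mx i : measurable_fun setT (x i). Proof. by case: law_x. Qed.

Lemma measurable_kcomp {d'} {T : measurableType d'} (a b : T -> X) :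
  measurable_fun setT a -> measurable_fun setT b ->
  measurable_fun setT (fun t => k (a t) (b t)).
Proof.
move=> ma mb; have := measurable_fun_pair ma mb.
by move=> /(measurableT_comp mk).
Qed.

Lemma measurable_kmean : measurable_fun setT m.
Proof. exact: (measurable_Rintegral_param P (fun p : X * X => k p.1 p.2)). Qed.

Lemma measurable_opnormG : measurable_fun setT (fun t => opnormG P k (x^~ t)).
Proof.
have mkk i j : measurable_fun setT (fun u : Omega * X => k (x i u.1) u.2 * k u.2 (x j u.1)).
  by apply: measurable_funM; apply: measurable_kcomp => //;
    exact: (measurableT_comp (mx _) measurable_fst).
rewrite /opnormG; apply: measurable_fun_ifT => //.
  apply: measurable_forallb => i; apply: measurable_fun_lte => //.
  apply: (measurable_ge0_integral_param P
    (fun u : Omega * X => k (x i u.1) u.2 * k u.2 (x i u.1))) => // u.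
  by rewrite [k u.2 _]ksym -expr2 sqr_ge0.
apply: measurable_opnorm; apply: mxmeasurable_mx => i j.
exact: (measurable_Rintegral_param P
  (fun u : Omega * X => k (x i u.1) u.2 * k u.2 (x j u.1))).
Qed.

Lemma opnormG_ge0 (xs : 'I_n -> X) : (0 <= opnormG P k xs)%E.
Proof. by rewrite /opnormG; case: ifP => // _; exact: opnorm_ge0. Qed.

(** The largest squared length of a row of [centered_kmat], that is, the quantity max |v|^2 of
    Rudelson's bound. *)
Definition max_fluctuation (y xs : 'I_n -> X) : R :=
  \big[Num.max/0]_(i < n) \sum_(j < n) (k (y i) (xs j) - m (xs j)) ^+ 2.

Lemma max_fluctuation_ge0 (y xs : 'I_n -> X) : 0 <= max_fluctuation y xs.
Proof. exact: bigmax_ge_id. Qed.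

Lemma conditional_rudelson (xs : 'I_n -> X) (p : nat) : (0 < n)%N -> (n <= 2 ^ p)%N ->
  (\int[P0]_t (opn (centered_kmat (x^~ t) xs) ^+ 2)%:E <=
   (6 * expR 1 * n%:R)%:E * opnormG P k xs +
   (14 * p.+1%:R)%:E * \int[P0]_t (max_fluctuation (x^~ t) xs)%:E)%E.
Proof.
move=> n0 np.
have e0 : 0 < 6 * expR 1 * n%:R :> R by rewrite !mulr_gt0 ?expR_gt0 ?ltr0n.
have p0 : 0 < 14 * p.+1%:R :> R by rewrite mulr_gt0.
pose l := (\int[P0]_t (max_fluctuation (x^~ t) xs)%:E)%E; rewrite -/l.
have l0 : (0 <= l)%E.
  by apply: integral_ge0 => t _; rewrite lee_fin max_fluctuation_ge0.
(* Both coefficients are positive, so an infinite [l] or an infinite norm of G makes the right side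
   infinite; afterwards everything is real. *)
have [->|lfin] := eqVneq l +oo%E.
  rewrite gt0_muley ?lte_fin// addey ?leey//.
  by rewrite -ltNye (lt_le_trans (ltNyr 0))// mule_ge0// ?lee_fin ?(ltW e0)// opnormG_ge0.
have [->|Gfin] := eqVneq (opnormG P k xs) +oo%E.
  rewrite gt0_muley ?lte_fin// addye ?leey//.
  by rewrite -ltNye (lt_le_trans (ltNyr 0))// mule_ge0// lee_fin ltW.
have lE : l = (fine l)%:E by rewrite fineK// ge0_fin_numE// lt_neqAle lfin leey.
move: Gfin; rewrite /opnormG; case: ifPn => [/forallP diag _|]; last by rewrite eqxx.
set G := (X in opnorm X); rewrite -opnE lE.
apply/lee_addgt0Pr => e ep.
pose v (y : X) : 'cV[R]_n := \col_j (k y (xs j) - m (xs j)).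
have mv : mxmeasurable v.
  apply: mxmeasurable_mx => j _; apply: measurable_funB => //.
  by apply: measurable_kcomp => //; exact: measurable_cst.
(* [rudelson] needs a positive bound while [l] may be 0; this slack costs exactly [e] after
   multiplication by its coefficient. *)
pose e' := e / (14 * p.+1%:R).
have ep' : 0 < e' by rewrite divr_gt0.
have lp : 0 < fine l + e' by rewrite ltr_wpDl// fine_ge0.
have cov (u : 'cV[R]_n) :
    (\int[P]_y ((\sum_a v y a 0 * u a 0) ^+ 2)%:E <= (opn G * sqnorm u)%:E)%E.
  pose q (j : 'I_n) y := k y (xs j).
  have mq j : measurable_fun setT (q j).
    by apply: measurable_kcomp => //; exact: measurable_cst.
  have q2 j : (\int[P]_y (q j y * q j y)%:E < +oo)%E.
    by have := diag j; under eq_integral do rewrite (ksym (xs j)).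
  have := covariance_qform_le P q u mq q2.
  have -> : (fun y => ((\sum_a (q a y - Rintegral P setT (q a)) * u a 0) ^+ 2)%:E) =
      (fun y => ((\sum_a v y a 0 * u a 0) ^+ 2)%:E).
    apply/funext => y; congr ((_ ^+ 2)%:E); apply: eq_bigr => a _.
    rewrite mxE; congr ((_ - _) * _); rewrite /m /q.
    by apply: eq_Rintegral => t _; rewrite ksym.
  move=> /le_trans; apply; rewrite lee_fin.
  have -> : \matrix_(i, j) Rintegral P setT (fun y => q i y * q j y) = G.
    apply/matrixP => i j; rewrite !mxE; apply: eq_Rintegral => y _.
    by rewrite /q (ksym _ (xs i)).
  exact: qform_le_opn.
have maxl : (\int[P0]_t (\big[Num.max/0]_(i < n) sqnorm (v (x i t)))%:E <= (fine l + e')%:E)%E.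
  rewrite EFinD -lE; apply: le_trans (_ : l <= _)%E; last by rewrite leeDl// lee_fin ltW.
  rewrite le_eqVlt; apply/orP; left; apply/eqP; apply: eq_integral => t _.
  congr (_%:E); apply: eq_bigr => i _; apply: eq_bigr => j _; by rewrite mxE.
have := rudelson P P0 x law_x v (opn G) (fine l + e') p mv (opn_ge0 G) lp cov maxl np.
have -> : (fun t => (opn (\matrix_(i, j) v (x i t) j 0) ^+ 2)%:E) =
    (fun t => (opn (centered_kmat (x^~ t) xs) ^+ 2)%:E).
  apply/funext => t; congr ((opn _ ^+ 2)%:E).
  by apply/matrixP => i j; rewrite !mxE.
move=> /le_trans; apply.
rewrite -!EFinM -!EFinD lee_fin mulrDr addrA lerD2l /e' mulrC divfK// gt_eqF//.
Qed.

Let mu := (P0 \x P0)%E.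

Let mx1 i : measurable_fun setT (fun u : Omega * Omega => x i u.1).
Proof. exact: (measurableT_comp (mx i) measurable_fst). Qed.

Let mx2 i : measurable_fun setT (fun u : Omega * Omega => x i u.2).
Proof. exact: (measurableT_comp (mx i) measurable_snd). Qed.

Lemma mxmeasurable_centered_kmat :
  mxmeasurable (fun u : Omega * Omega => centered_kmat (x^~ u.2) (x^~ u.1)).
Proof.
apply: mxmeasurable_mx => i j; apply: measurable_funB.
  exact: measurable_kcomp.
exact: (measurableT_comp measurable_kmean).
Qed.

Lemma measurable_max_fluctuation : measurable_fun setT
  (fun u : Omega * Omega => max_fluctuation (x^~ u.2) (x^~ u.1)).
Proof.
apply: measurable_bigmax => i; apply: measurable_sum => j; apply: measurable_funX.
apply: measurable_funB; first exact: measurable_kcomp.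
exact: (measurableT_comp measurable_kmean).
Qed.

Definition expected_max_deviation : \bar R :=
  (\int[P0]_w (\big[Num.max/0]_(i < n) (k (z w) (x i w) - m (z w)) ^+ 2)%:E)%E.

(** A maximum of sums is at most the sum of the maxima, and by symmetry of [k] each of the n columns
    contributes the same expectation, with the column point in the role of [z]. *)
Lemma integral_max_fluctuation_le :
  (\int[mu]_u (max_fluctuation (x^~ u.2) (x^~ u.1))%:E <=
   n%:R%:E * expected_max_deviation)%E.
Proof.
pose f (y : family_space X (option 'I_n)) : \bar R :=
  (\big[Num.max/0]_(i < n) (k (y None) (y (Some i)) - m (y None)) ^+ 2)%:E.
have mf : measurable_fun setT f.
  apply/measurable_EFinP; apply: measurable_bigmax => i; apply: measurable_funX.
  apply: measurable_funB.
    apply: (@measurable_kcomp _ (family_space X (option 'I_n))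
      (fun y => y None) (fun y => y (Some i))).
      exact: (measurable_coord None).
    exact: (measurable_coord (Some i)).
  exact: (measurableT_comp measurable_kmean (measurable_coord None)).
have f0 y : (0 <= f y)%E by rewrite lee_fin bigmax_ge_id.
have E0 : (0 <= expected_max_deviation)%E.
  apply: integral_ge0 => t _; exact: (f0 (fun o => if o is Some i then x i t else z t)).
(* One column point from the first copy together with all row points of the second: being from
   different copies, they have the law of (z, x_1, ..., x_n), also when the indices coincide. *)
pose y j (o : option 'I_n) (u : Omega * Omega) := if o is Some i then x i u.2 else x j u.1.
have ly j : iid_family (P0 \x P0)%E P (y j).
  have sI : injective (fun o : option 'I_n =>
      if o is Some i then inr i else inl j : 'I_n + 'I_n) by move=> [a|] [b|] // [->].
  have := iid_family_sub _ _ _ _ sI (iid_family_prod P P0 P0 x x law_x law_x).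
  rewrite (_ : (fun _ => _) = y j)//.
  by apply/funext => -[i|].
have fE j : (\int[mu]_u f ((y j)^~ u) = expected_max_deviation)%E.
  exact: (iid_family_law_unique P (P0 \x P0)%E P0 (y j) _ f (ly j) iid mf f0).
have mfy j : measurable_fun setT (fun u => f ((y j)^~ u)).
  by apply: (measurableT_comp mf); apply: measurable_family; case: (ly j).
apply: (@le_trans _ _ (\int[mu]_u \sum_(j < n) f ((y j)^~ u))%E).
  apply: ge0_le_integral_mu.
  - by apply/measurable_EFinP; exact: measurable_max_fluctuation.
  - exact: emeasurable_sum.
  - by move=> u; rewrite lee_fin max_fluctuation_ge0.
  move=> u; rewrite sumEFin lee_fin; apply/bigmax_leP; split.
    by apply: sumr_ge0 => j _; rewrite -lee_fin; exact: (f0 ((y j)^~ u)).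
  move=> i _; apply: ler_sum => j _; rewrite (bigD1 i)//= le_max.
  by rewrite (ksym (x i u.2)) lexx.
rewrite ge0_integral_sum//.
rewrite (eq_bigr (fun=> expected_max_deviation)) => [|j _]; last exact: fE.
by rewrite sume_cst_ord.
Qed.

Lemma integral_centered_kmat_le (p : nat) : (0 < n)%N -> (n <= 2 ^ p)%N ->
  (\int[mu]_u (opn (centered_kmat (x^~ u.2) (x^~ u.1)) ^+ 2)%:E <=
   (6 * expR 1 * n%:R)%:E * \int[P0]_t opnormG P k (x^~ t) +
   (14 * p.+1%:R)%:E * (n%:R%:E * expected_max_deviation))%E.
Proof.
move=> n0 np.
have e0 : 0 <= 6 * expR 1 * n%:R :> R by rewrite !mulr_ge0 ?expR_ge0.
have p0 : 0 <= 14 * p.+1%:R :> R by rewrite mulr_ge0.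
have mo : measurable_fun setT (fun u : Omega * Omega =>
    (opn (centered_kmat (x^~ u.2) (x^~ u.1)) ^+ 2)%:E).
  apply/measurable_EFinP; apply: measurable_funX; apply: measurable_opn.
  exact: mxmeasurable_centered_kmat.
have o0 u : (0 <= (opn (centered_kmat (x^~ u.2) (x^~ u.1)) ^+ 2)%:E)%E.
  by rewrite lee_fin sqr_ge0.
have mM : measurable_fun setT (fun u : Omega * Omega =>
    (max_fluctuation (x^~ u.2) (x^~ u.1))%:E).
  by apply/measurable_EFinP; exact: measurable_max_fluctuation.
have M0 u : (0 <= (max_fluctuation (x^~ u.2) (x^~ u.1))%:E)%E.
  by rewrite lee_fin max_fluctuation_ge0.
rewrite fubini_tonelli1//.
pose l t := (\int[P0]_t' (max_fluctuation (x^~ t') (x^~ t))%:E)%E.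
have ml : measurable_fun setT l.
  exact: (measurable_fun_fubini_tonelli_F (fun u : Omega * Omega =>
    (max_fluctuation (x^~ u.2) (x^~ u.1))%:E)).
have l0 t : (0 <= l t)%E by apply: integral_ge0 => t' _; exact: (M0 (t, t')).
have mG := measurable_opnormG.
apply: (@le_trans _ _ (\int[P0]_t ((6 * expR 1 * n%:R)%:E * opnormG P k (x^~ t) +
    (14 * p.+1%:R)%:E * l t))%E).
  apply: ge0_le_integral_mu.
  - exact: (measurable_fun_fubini_tonelli_F (fun u : Omega * Omega =>
      (opn (centered_kmat (x^~ u.2) (x^~ u.1)) ^+ 2)%:E)).
  - by apply: emeasurable_funD; apply: emeasurable_funM.
  - by move=> t; apply: integral_ge0 => t' _; exact: (o0 (t, t')).
  - by move=> t; have := conditional_rudelson (x^~ t) p n0 np; rewrite /fubini_F.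
rewrite ge0_integralD//; last 4 first.
- by move=> t _; apply: mule_ge0; rewrite ?lee_fin// opnormG_ge0.
- by apply: emeasurable_funM.
- by move=> t _; apply: mule_ge0; rewrite ?lee_fin// l0.
- by apply: emeasurable_funM.
rewrite ge0_integralZl_EFin//; last by move=> t _; exact: opnormG_ge0.
rewrite ge0_integralZl_EFin// leeD2l// lee_wpmul2l ?lee_fin//.
by apply: le_trans integral_max_fluctuation_le; rewrite fubini_tonelli1.
Qed.

Definition cross_kmat (u : Omega * Omega) : 'M[R]_n :=
  \matrix_(i, j) k (x i u.2) (x j u.1).

Lemma mxmeasurable_cross_kmat : mxmeasurable cross_kmat.
Proof. by apply: mxmeasurable_mx => i j; exact: measurable_kcomp. Qed.

(** The subtracted means form a matrix with n identical rows, of rank at most one, whose squared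
    norm is at most n times that of the common row; then (a + b)^2 <= 2 a^2 + 2 b^2. *)
Lemma opn_cross_kmat_sqr_le (u : Omega * Omega) :
  opn (cross_kmat u) ^+ 2 <= 2 * opn (centered_kmat (x^~ u.2) (x^~ u.1)) ^+ 2 +
    2 * (n%:R * \sum_(j < n) m (x j u.1) ^+ 2).
Proof.
set A := centered_kmat _ _.
pose B : 'M[R]_n := \matrix_(i, j) m (x j u.1).
have BE : opn B ^+ 2 <= n%:R * \sum_(j < n) m (x j u.1) ^+ 2.
  apply: opn_sqr_le; first by rewrite mulr_ge0// sumr_ge0// => j _; rewrite sqr_ge0.
  move=> v; rewrite -mulrA mulr_natl -[X in _ *+ X]card_ord -sumr_const.
  apply: ler_sum => i _; rewrite mxE.
  have -> : \sum_j B i j * v j 0 = \sum_j m (x j u.1) * v j 0.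
    by apply: eq_bigr => j _; rewrite mxE.
  exact: (sum_cauchy_schwarz (fun j => m (x j u.1)) (fun j => v j 0)).
have KE : cross_kmat u = A + B.
  by apply/matrixP => i j; rewrite !mxE subrK.
have := opnD A B; rewrite -KE => h.
apply: (@le_trans _ _ ((opn A + opn B) ^+ 2)).
  by rewrite lerXn2r ?nnegrE ?addr_ge0 ?opn_ge0.
apply: (@le_trans _ _ (2 * opn A ^+ 2 + 2 * opn B ^+ 2)).
  by have := sqr_ge0 (opn A - opn B); nra.
by rewrite lerD2l ler_wpM2l.
Qed.

Definition kmean_second_moment : \bar R :=
  (\int[P]_y ((Rintegral P setT (fun t => k y t)) ^+ 2)%:E)%E.

Lemma integral_cross_kmat_le (p : nat) : (0 < n)%N -> (n <= 2 ^ p)%N ->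
  (\int[mu]_u (opn (cross_kmat u) ^+ 2)%:E <=
   (12 * expR 1 * n%:R)%:E * \int[P0]_t opnormG P k (x^~ t) +
   (28 * p.+1%:R * n%:R)%:E * expected_max_deviation +
   (2 * n%:R ^+ 2)%:E * kmean_second_moment)%E.
Proof.
move=> n0 np.
have mo : measurable_fun setT (fun u : Omega * Omega =>
    (opn (centered_kmat (x^~ u.2) (x^~ u.1)) ^+ 2)%:E).
  apply/measurable_EFinP; apply: measurable_funX; apply: measurable_opn.
  exact: mxmeasurable_centered_kmat.
have o0 u : (0 <= (opn (centered_kmat (x^~ u.2) (x^~ u.1)) ^+ 2)%:E)%E.
  by rewrite lee_fin sqr_ge0.
pose s j (u : Omega * Omega) := (m (x j u.1) ^+ 2)%:E.
have mms : measurable_fun setT (fun y => (m y ^+ 2)%:E).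
  by apply/measurable_EFinP; apply: measurable_funX; exact: measurable_kmean.
have ms j : measurable_fun setT (s j).
  exact: (measurableT_comp mms (mx1 j)).
have s0 j u : (0 <= s j u)%E by rewrite lee_fin sqr_ge0.
have sE j : (\int[mu]_u s j u = kmean_second_moment)%E.
  have lp := iid_family_prod P P0 P0 x x law_x law_x.
  apply: (iid_family_marginal P (P0 \x P0)%E _ (inl j) (fun y => (m y ^+ 2)%:E) lp mms).
  by move=> y; rewrite lee_fin sqr_ge0.
have q0 : (0 <= kmean_second_moment)%E.
  by apply: integral_ge0 => y _; rewrite lee_fin sqr_ge0.
pose F u := (2%:E * (opn (centered_kmat (x^~ u.2) (x^~ u.1)) ^+ 2)%:E +
  (2 * n%:R)%:E * \sum_(j < n) s j u)%E.
have n20 : 0 <= 2 * n%:R :> R by rewrite mulr_ge0.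
have msum : measurable_fun setT (fun u => \sum_(j < n) s j u)%E.
  exact: emeasurable_sum.
have sum0 u : (0 <= \sum_(j < n) s j u)%E by apply: sume_ge0.
apply: (@le_trans _ _ (\int[mu]_u F u)%E).
  apply: ge0_le_integral_mu.
  - apply/measurable_EFinP; apply: measurable_funX; apply: measurable_opn.
    exact: mxmeasurable_cross_kmat.
  - by apply: emeasurable_funD; apply: emeasurable_funM.
  - by move=> u; rewrite lee_fin sqr_ge0.
  move=> u; rewrite /F /s sumEFin -!EFinM -EFinD lee_fin -mulrA.
  exact: opn_cross_kmat_sqr_le.
rewrite ge0_integralD//; last 4 first.
- by move=> u _; apply: mule_ge0; rewrite ?o0// lee_fin.
- by apply: emeasurable_funM.
- by move=> u _; apply: mule_ge0; rewrite ?sum0// lee_fin.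
- by apply: emeasurable_funM.
rewrite ge0_integralZl_EFin// ge0_integralZl_EFin// ge0_integral_sum//.
rewrite (eq_bigr (fun=> kmean_second_moment)) => [|j _]; last exact: sE.
rewrite sume_cst_ord//; apply: leeD.
  apply: le_trans (lee_wpmul2l _ (integral_centered_kmat_le p n0 np)) _.
    by rewrite lee_fin.
  rewrite ge0_muleDr; last 2 first.
  - apply: mule_ge0; first by rewrite lee_fin !mulr_ge0 ?expR_ge0.
    by apply: integral_ge0 => t _; exact: opnormG_ge0.
  - apply: mule_ge0; first by rewrite lee_fin mulr_ge0.
    apply: mule_ge0; first by rewrite lee_fin.
    by apply: integral_ge0 => t _; rewrite lee_fin bigmax_ge_id.
  rewrite !muleA -!EFinM.
  rewrite le_eqVlt; apply/orP; left; apply/eqP.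
  by congr (_%:E * _ + _%:E * _)%E; ring.
rewrite muleA -EFinM le_eqVlt; apply/orP; left; apply/eqP.
by congr (_%:E * _)%E; ring.
Qed.

(** For each index set the masked matrix uses its row points and column points at disjoint indices,
    so resampling the row points turns it into a masked cross matrix. The 2^n sets, weighted by 4 /
    2^n, give the factor 4. *)
Lemma integral_opnorm_kmat_le :
  (\int[P0]_w opnorm (kmat k (fun i => x i w)) <=
   \int[P0]_w (\big[Num.max/0]_(i < n) `|k (x i w) (x i w)|)%:E +
   4%:E * \int[mu]_u (opn (cross_kmat u))%:E)%E.
Proof.
pose D w := \big[Num.max/0]_(i < n) `|k (x i w) (x i w)|.
have mD : measurable_fun setT (fun w => (D w)%:E).
  apply/measurable_EFinP; apply: measurable_bigmax => i.
  by apply: measurableT_comp => //; exact: measurable_kcomp.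
have D0 w : 0 <= D w by exact: bigmax_ge_id.
pose B (T : {set 'I_n}) (y : 'I_n -> X) : 'M[R]_n :=
  \matrix_(i, j) (((i \in T) && (j \notin T))%:R * kmat k y i j).
have mB T : mxmeasurable (fun y : family_space X 'I_n => B T y).
  apply: (@mxmeasurable_mx _ _ (family_space X 'I_n) _ _ (fun i j y =>
    ((i \in T) && (j \notin T))%:R * kmat k y i j)) => i j.
  apply: measurable_funM => //.
  have -> : (fun y : family_space X 'I_n => kmat k y i j) = (fun y => k (y i) (y j)).
    by apply/funext => y; rewrite mxE.
  apply: (@measurable_kcomp _ (family_space X 'I_n) (fun y => y i) (fun y => y j)).
    exact: (measurable_coord i).
  exact: (measurable_coord j).
pose f (T : {set 'I_n}) (y : family_space X 'I_n) := (opn (B T y))%:E.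
have mf T : measurable_fun setT (f T).
  by apply/measurable_EFinP; exact: measurable_opn.
have f0 T y : (0 <= f T y)%E by rewrite lee_fin opn_ge0.
have mW := measurable_family x mx.
have mfw T : measurable_fun setT (fun w => f T (x^~ w)) := measurableT_comp (mf T) mW.
have c0 : 0 <= 4 / 2 ^+ n :> R by rewrite divr_ge0// exprn_ge0.
have fT T : (\int[P0]_w f T (x^~ w) <= \int[mu]_u (opn (cross_kmat u))%:E)%E.
  have ls := iid_family_splice P (mem T) P0 x law_x.
  rewrite (iid_family_law_unique P P0 (P0 \x P0)%E x _ (f T) law_x ls (mf T) (f0 T)).
  apply: ge0_le_integral_mu.
  - by apply: (measurableT_comp (mf T)); apply: measurable_family; case: ls.
  - by apply/measurable_EFinP; apply: measurable_opn; exact: mxmeasurable_cross_kmat.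
  - by move=> u; exact: f0.
  move=> u; rewrite lee_fin.
  (* Where the mask is nonzero, [i] lies in [T] and reads the second copy, [j] lies outside and
     reads the first. *)
  have -> : B T (splice (mem T) x u) = \matrix_(i, j)
      (((i \in T) && (j \notin T))%:R * cross_kmat u i j).
    apply/matrixP => i j; rewrite !mxE /splice/=.
    by case: (boolP (i \in T)) => iT; case: (boolP (j \in T)) => jT //=; rewrite !mul0r.
  exact: (opn_mask (fun i => i \in T) (fun j => j \notin T)).
apply: (@le_trans _ _ (\int[P0]_w ((D w)%:E +
    (4 / 2 ^+ n)%:E * \sum_(T : {set 'I_n}) f T (x^~ w)))%E).
  apply: ge0_le_integral_mu.
  - apply: measurable_opnorm; apply: mxmeasurable_mx => i j; exact: measurable_kcomp.
  - apply: emeasurable_funD => //; apply: emeasurable_funM => //.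
    exact: emeasurable_sum.
  - by move=> w; exact: opnorm_ge0.
  move=> w; rewrite -opnE sumEFin -EFinM -EFinD lee_fin.
  apply: opn_decoupling => // i; rewrite mxE /D (bigD1 i)//= le_max lexx//.
have ms : measurable_fun setT (fun w => \sum_(T : {set 'I_n}) f T (x^~ w))%E.
  exact: emeasurable_sum.
have s0 w : (0 <= \sum_(T : {set 'I_n}) f T (x^~ w))%E by apply: sume_ge0.
rewrite ge0_integralD//; last 3 first.
- by move=> w _; rewrite lee_fin.
- by move=> w _; apply: mule_ge0; rewrite ?s0// lee_fin.
- by apply: emeasurable_funM.
rewrite leeD2l// ge0_integralZl_EFin// ge0_integral_sum//.
have -> : 4%:E = ((4 / 2 ^+ n)%:E * (2 ^+ n)%:E)%E :> \bar R.
  by rewrite -EFinM divfK// expf_neq0.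
rewrite -muleA; apply: lee_wpmul2l; first by rewrite lee_fin.
apply: (@le_trans _ _ (\sum_(T : {set 'I_n}) \int[mu]_u (opn (cross_kmat u))%:E)%E).
  by apply: lee_sum => T _; exact: fT.
have K0 : (0 <= \int[mu]_u (opn (cross_kmat u))%:E)%E.
  by apply: integral_ge0 => u _; rewrite lee_fin opn_ge0.
rewrite -card_set_natr -sume_cst_ord// le_eqVlt; apply/orP; left; apply/eqP.
by rewrite !big_const card_ord.
Qed.

End kernel.

(** * Conclusion *)

(** With p the rounded-up binary logarithm, 2^(p-1) < n and ln 2 <= ln n give (p + 1) ln 2 <= 3 ln
    n. *)
Lemma up_log_le_ln {R : realType} (n : nat) : (2 <= n)%N ->
  (up_log 2 n).+1%:R <= 4 / ln 2 * ln n%:R :> R.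
Proof.
move=> n2; set p := up_log 2 n.
have l2 : 0 < ln (2 : R) by rewrite ln_gt0// ltr1n.
have p0 : (0 < p)%N by rewrite up_log_gt0.
have ln2n : ln (2 : R) <= ln n%:R by rewrite ler_ln ?posrE ?ltr0n ?ler_nat// (leq_trans _ n2).
have pln : p.-1%:R * ln 2 <= ln n%:R :> R.
  rewrite mulr_natl -lnXn// ler_ln ?posrE ?exprn_gt0 ?ltr0n// ?(leq_trans _ n2)//.
  by rewrite -natrX ler_nat ltnW// up_log_gtn.
have -> : p.+1%:R = (p.-1%:R + 2 : R) by rewrite -[p in LHS](prednK p0) -natrD addn2.
rewrite mulrAC ler_pdivlMr// mulrDl.
by lra.
Qed.

Lemma opn_amgm {R : realType} (a t : R) : 0 < t -> a <= t + t^-1 * a ^+ 2.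
Proof.
move=> t0; rewrite -(ler_pM2l t0) mulrDr mulrA mulfV ?gt_eqF// mul1r.
by have := sqr_ge0 (a - t); have := sqr_ge0 a; nra.
Qed.

Lemma sqrte_prod_sqr {R : realType} (a : R) (y : \bar R) : (0 <= y)%E ->
  ((a%:E * sqrte y) * (a%:E * sqrte y) = (a * a)%:E * y)%E.
Proof.
move=> y0; rewrite muleACA -EFinM; congr (_ * _)%E.
by rewrite -[RHS](sqr_sqrte y0) expe2.
Qed.

(* Linearizing through [a <= t + a^2/t] avoids taking the square root of an
   extended-real integral. *)
Lemma integral_le_sum_of_squares {R : realType} {d} {T : measurableType d}
    (mu : probability T R) (f : T -> R) (b1 b2 b3 : \bar R) (C : R) :
  measurable_fun setT f -> (forall t, 0 <= f t) ->
  (0 <= b1)%E -> (0 <= b2)%E -> (0 <= b3)%E -> 0 < C ->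
  (\int[mu]_t (f t ^+ 2)%:E <= C%:E * (b1 * b1 + b2 * b2 + b3 * b3))%E ->
  (\int[mu]_t (f t)%:E <= (1 + C)%:E * (b1 + b2 + b3))%E.
Proof.
move=> mf f0 b10 b20 b30 C0 h.
have C1 : 0 < 1 + C by rewrite addr_gt0.
have [s|sfin] := eqVneq (b1 + b2 + b3)%E +oo%E.
  by rewrite s gt0_muley ?lte_fin// leey.
have s0 : (0 <= b1 + b2 + b3)%E by rewrite !adde_ge0.
have fin : (b1 + b2 + b3)%E \is a fin_num by rewrite ge0_fin_numE// lt_neqAle sfin leey.
move: (fin); rewrite !fin_numD => /andP[/andP[f1 f2] f3].
move: h b10 b20 b30; rewrite -(fineK f1) -(fineK f2) -(fineK f3).
set a1 := fine b1; set a2 := fine b2; set a3 := fine b3.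
rewrite !lee_fin => h a10 a20 a30; pose s := a1 + a2 + a3.
have -> : ((1 + C)%:E * (a1%:E + a2%:E + a3%:E) = ((1 + C) * s)%:E)%E by [].
have {}h : (\int[mu]_t (f t ^+ 2)%:E <= (C * (a1 * a1 + a2 * a2 + a3 * a3))%:E)%E by exact: h.
have sp : 0 <= s by rewrite !addr_ge0.
(* The linearization is nearly optimal at t = s; the shift by [e] permits the division when s = 0.
   Then (a1^2 + a2^2 + a3^2) / t <= s^2 / t <= s. *)
apply/lee_addgt0Pr => e e0; pose t := s + e.
have t0 : 0 < t by rewrite ltr_wpDl.
have mf2 : measurable_fun setT (fun u => (f u ^+ 2)%:E).
  by apply/measurable_EFinP; exact: measurable_funX.
apply: (@le_trans _ _ (\int[mu]_u (t%:E + (t^-1)%:E * (f u ^+ 2)%:E))%E).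
  apply: ge0_le_integral_mu.
  - exact/measurable_EFinP.
  - by apply: emeasurable_funD => //; apply: emeasurable_funM.
  - by move=> u; rewrite lee_fin.
  - by move=> u; rewrite -EFinM -EFinD lee_fin opn_amgm.
have ti0 : 0 <= t^-1 by rewrite invr_ge0 ltW.
rewrite ge0_integralD//; last 3 first.
- by move=> u _; rewrite lee_fin ltW.
- by move=> u _; rewrite -EFinM lee_fin mulr_ge0// sqr_ge0.
- by apply: emeasurable_funM.
rewrite integral_prob_cst ge0_integralZl_EFin//; last first.
  by move=> u _; rewrite lee_fin sqr_ge0.
apply: (@le_trans _ _ (t%:E + (t^-1)%:E * (C * (a1 * a1 + a2 * a2 + a3 * a3))%:E)%E).
  by rewrite leeD2l// lee_wpmul2l// lee_fin.
rewrite -EFinM -!EFinD lee_fin -/s.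
have h2 : t^-1 * (C * (a1 * a1 + a2 * a2 + a3 * a3)) <= C * s.
  rewrite ler_pdivrMl// mulrCA ler_wpM2l ?(ltW C0)//.
  apply: (@le_trans _ _ (s * s)); last by rewrite ler_wpM2r// lerDl ltW.
  rewrite /s; have := mulr_ge0 a10 a20; have := mulr_ge0 a10 a30.
  by have := mulr_ge0 a20 a30; nra.
by apply: le_trans (lerD (lexx t) h2) _; rewrite /t; lra.
Qed.

Theorem theorem1 (R : realType) :
  exists C : R, 0 < C /\
  forall (d dX : measure_display) (Omega : measurableType d) (X : measurableType dX)
    (P0 : probability Omega R) (P : probability X R) (k : X -> X -> R)
    (n : nat) (z : Omega -> X) (x : 'I_n -> Omega -> X),
    measurable_fun setT (fun p : X * X => k p.1 p.2) ->
    psd_kernel k ->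
    (P \x P)%E.-integrable setT (fun p : X * X => (k p.1 p.2)%:E) ->
    (2 <= n)%N ->
    iid_sample P0 P z x ->
    (\int[P0]_w opnorm (kmat k (fun i => x i w))
     <= C%:E *
        (\int[P0]_w (\big[Num.max/0]_(i < n) `|k (x i w) (x i w)|)%:E
         + (n%:R)%:E
             * sqrte ((ln (n%:R : R))%:E
                 * \int[P]_y ((Rintegral P setT (fun t => k y t)) ^+ 2)%:E)
         + sqrte ((n%:R * (ln (n%:R : R)))%:E * \int[P0]_w opnormG P k (fun i => x i w))
         + (ln (n%:R : R))%:E
             * sqrte ((n%:R)%:E
                 * \int[P0]_w (\big[Num.max/0]_(i < n)
                      (k (z w) (x i w) - Rintegral P setT (fun t => k (z w) t)) ^+ 2)%:E)))%E.
Proof.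
pose c : R := 4 / ln 2.
have l2 : 0 < ln (2 : R) by rewrite ln_gt0// ltr1n.
have c0 : 0 < c by rewrite divr_gt0.
(* The coefficients of [integral_cross_kmat_le], with p + 1 <= c ln n, and with 1 <= c ln n
   supplying each logarithm of the stated bound that is missing there. *)
pose C2 : R := 12 * expR 1 * c + 28 * c * c + 2 * c.
have e0 : 0 < expR (1 : R) := expR_gt0 _.
have ec0 := mulr_gt0 e0 c0; have cc0 := mulr_gt0 c0 c0.
have C20 : 0 < C2 by rewrite /C2; lra.
(* The 4 comes from decoupling, 1 + C2 from passing from the second moment to the first. *)
exists (4 * (1 + C2)); split; first by lra.
move=> d dX Omega X P0 P k n z x mk [ksym _] _ n2 iid.
have n0 : (0 < n)%N by exact: leq_trans n2.
pose p := up_log 2 n; have np : (n <= 2 ^ p)%N by exact: up_logP.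
pose l : R := ln n%:R; rewrite -/l.
have pl : p.+1%:R <= c * l := up_log_le_ln n n2.
have cl1 : 1 <= c * l by apply: le_trans pl; rewrite ler1n.
have l0 : 0 < l by rewrite ln_gt0// ltr1n.
have cross := integral_cross_kmat_le P0 P k z x mk ksym iid p n0 np.
have decoupled := integral_opnorm_kmat_le P0 P k z x mk iid.
set D := (\int[P0]_w (\big[Num.max/0]_(i < n) _)%:E)%E in decoupled *.
set V := (\int[P]_y _)%E; set G := (\int[P0]_w opnormG _ _ _)%E.
set E := (\int[P0]_w (\big[Num.max/0]_(i < n) _ ^+ 2)%:E)%E.
have D0 : (0 <= D)%E.
  by apply: integral_ge0 => w _; rewrite lee_fin bigmax_ge_id.
have V0 : (0 <= V)%E by apply: integral_ge0 => y _; rewrite lee_fin sqr_ge0.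
have G0 : (0 <= G)%E by apply: integral_ge0 => w _; exact: opnormG_ge0.
have E0 : (0 <= E)%E.
  by apply: integral_ge0 => w _; rewrite lee_fin bigmax_ge_id.
set b1 := (n%:R%:E * sqrte _)%E; set b2 := sqrte _; set b3 := (l%:E * sqrte _)%E.
have b10 : (0 <= b1)%E by apply: mule_ge0; rewrite ?sqrte_ge0// lee_fin.
have b20 : (0 <= b2)%E by exact: sqrte_ge0.
have b30 : (0 <= b3)%E by apply: mule_ge0; rewrite ?sqrte_ge0// lee_fin ltW.
have b1E : (b1 * b1 = (n%:R * n%:R * l)%:E * V)%E.
  rewrite /b1 sqrte_prod_sqr; last by apply: mule_ge0; rewrite // lee_fin ltW.
  by rewrite muleA -EFinM.
have b2E : (b2 * b2 = (n%:R * l)%:E * G)%E.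
  rewrite -expe2 sqr_sqrte//; apply: mule_ge0 => //.
  by rewrite lee_fin mulr_ge0// ltW.
have b3E : (b3 * b3 = (l * l * n%:R)%:E * E)%E.
  rewrite /b3 sqrte_prod_sqr; last by apply: mule_ge0; rewrite // lee_fin.
  by rewrite muleA -EFinM.
have nR0 : 0 <= n%:R :> R by [].
have squares : (\int[(P0 \x P0)%E]_u (opn (cross_kmat k x u) ^+ 2)%:E <=
    C2%:E * (b1 * b1 + b2 * b2 + b3 * b3))%E.
  apply: le_trans cross _; rewrite b1E b2E b3E.
  have w1 : 12 * expR 1 * n%:R <= C2 * (n%:R * l).
    rewrite (mulrC n%:R) mulrA ler_wpM2r//.
    apply: (@le_trans _ _ (12 * expR 1 * (c * l))); first by rewrite ler_peMr// mulr_ge0// ltW.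
    by rewrite mulrA ler_wpM2r ?(ltW l0)// /C2; lra.
  have w2 : 28 * p.+1%:R * n%:R <= C2 * (l * l * n%:R).
    rewrite mulrA ler_wpM2r//.
    apply: (@le_trans _ _ (28 * ((c * l) * (c * l)))).
      by apply: ler_wpM2l => //; rewrite -[leLHS]mulr1; apply: ler_pM.
    have -> : 28 * (c * l * (c * l)) = 28 * c * c * (l * l) by ring.
    by rewrite ler_wpM2r ?mulr_ge0 ?(ltW l0)// /C2; lra.
  have w3 : 2 * n%:R ^+ 2 <= C2 * (n%:R * n%:R * l).
    have -> : C2 * (n%:R * n%:R * l) = C2 * l * n%:R ^+ 2 by ring.
    rewrite ler_wpM2r ?sqr_ge0//.
    apply: (@le_trans _ _ (2 * (c * l))); first by rewrite ler_peMr.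
    by rewrite mulrA ler_wpM2r ?(ltW l0)// /C2; lra.
  have y1 : (0 <= (n%:R * n%:R * l)%:E * V)%E by rewrite mule_ge0// lee_fin !mulr_ge0// ltW.
  have y2 : (0 <= (n%:R * l)%:E * G)%E by rewrite mule_ge0// lee_fin !mulr_ge0// ltW.
  have y3 : (0 <= (l * l * n%:R)%:E * E)%E by rewrite mule_ge0// lee_fin !mulr_ge0// ltW.
  have y12 := adde_ge0 y1 y2.
  rewrite [leRHS]ge0_muleDr// [X in (_ <= X + _)%E]ge0_muleDr// !muleA -!EFinM.
  rewrite [leLHS]addeC [leLHS]addeA.
  by apply: leeD; [apply: leeD|]; apply: lee_wpmul2r; rewrite ?lee_fin.
have mcross : measurable_fun setT (fun u : Omega * Omega => opn (cross_kmat k x u)).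
  apply: measurable_opn; exact: (mxmeasurable_cross_kmat P0 P k z x mk iid).
have cross1 := integral_le_sum_of_squares (P0 \x P0)%E _ b1 b2 b3 C2 mcross
  (fun u => opn_ge0 _) b10 b20 b30 C20 squares.
apply: le_trans decoupled _; rewrite -[in leRHS]addeA -[in leRHS]addeA.
have s0 : (0 <= b1 + (b2 + b3))%E by rewrite !adde_ge0.
rewrite [leRHS]ge0_muleDr//; apply: leeD.
  rewrite -[leLHS]mul1e; apply: lee_wpmul2r => //.
  by rewrite lee_fin; lra.
by rewrite EFinM -muleA; apply: lee_wpmul2l; rewrite ?lee_fin// addeA.
Qed.
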